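(* Let $\mathsf{K}$ be a subvariety of $\mathsf{KG}$. If $\mathsf{K}$ has the ES property, then $\mathsf{K}$ is locally finite.
   Context: Heyting algebras are algebras $\langle A;\wedge,\vee,\to,0,1\rangle$. A homomorphism $f\colon\mathbf{A}\to\mathbf{B}$ in a variety $\mathsf{K}$ is an epimorphism if for all $\mathbf{C}\in\mathsf{K}$ and homomorphisms $g,h\colon\mathbf{B}\to\mathbf{C}$, $g\circ f=h\circ f$ implies $g=h$; $\mathsf{K}$ has the ES property if all its epimorphisms are surjective. A variety is locally finite if its finitely generated members are finite. For Heyting algebras $\mathbf{A},\mathbf{B}$, the sum $\mathbf{A}+\mathbf{B}$ is the Heyting algebra obtained by placing $\mathbf{B}$ below $\mathbf{A}$ and identifying the top element of $\mathbf{B}$ with the bottom element of $\mathbf{A}$ (universe $(A\smallsetminus\{0^{\mathbf{A}}\})\cup B$, every element of $B$ below every element of $A$); $\mathbf{A}_1+\dots+\mathbf{A}_n$ has $\mathbf{A}_1$ on top. The Kuznetsov–Gerčiu variety $\mathsf{KG}$ is the variety generated by all finite sums $\mathbf{A}_1+\dots+\mathbf{A}_n$ ($n\geq 1$) where each $\mathbf{A}_i$ is a one-generated Heyting algebra (equivalently a homomorphic image of the Rieger–Nishimura lattice, the free one-generated Heyting algebra). *)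

(* Defs.v *)
From mathcomp Require Import all_boot.
From mathcomp Require Import boolp classical_sets cardinality.

Set Implicit Arguments.
Unset Strict Implicit.
Unset Printing Implicit Defensive.

Local Open Scope classical_set_scope.

(* The trivial algebra (0 = 1) is allowed, as varieties require. *)
Record heyting : Type := Heyting {
  hcar :> Type;
  hmeet : hcar -> hcar -> hcar;
  hjoin : hcar -> hcar -> hcar;
  himp : hcar -> hcar -> hcar;
  hbot : hcar;
  htop : hcar;
  hmeetC : forall x y, hmeet x y = hmeet y x;
  hmeetA : forall x y z, hmeet x (hmeet y z) = hmeet (hmeet x y) z;
  hjoinC : forall x y, hjoin x y = hjoin y x;
  hjoinA : forall x y z, hjoin x (hjoin y z) = hjoin (hjoin x y) z;
  hmeetKU : forall x y, hmeet x (hjoin x y) = x;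
  hjoinKI : forall x y, hjoin x (hmeet x y) = x;
  hmeet0x : forall x, hmeet hbot x = hbot;
  hmeetx1 : forall x, hmeet x htop = x;
  hresid : forall x y z,
    hmeet (hmeet x y) z = hmeet x y <-> hmeet x (himp y z) = x
}.

Arguments hbot {h}.
Arguments htop {h}.

Definition hle (A : heyting) (x y : A) : Prop := hmeet x y = x.

Section HeytingOrder.
Variable A : heyting.
Implicit Types x y z : A.

Lemma hle_refl x : hle x x.
Proof. by rewrite /hle -{2}(hjoinKI x x) hmeetKU. Qed.

Lemma hle_trans y x z : hle x y -> hle y z -> hle x z.
Proof. by rewrite /hle => xy yz; rewrite -xy -hmeetA yz. Qed.

Lemma hle_anti x y : hle x y -> hle y x -> x = y.
Proof. by rewrite /hle => xy yx; rewrite -xy hmeetC yx. Qed.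

Lemma hle_meet z x y : hle z (hmeet x y) <-> hle z x /\ hle z y.
Proof.
split=> [h|[zx zy]]; last by rewrite /hle hmeetA zx zy.
split; apply: hle_trans h _; rewrite /hle; last by rewrite -hmeetA hle_refl.
by rewrite hmeetC hmeetA hle_refl.
Qed.

Lemma hle_joinE x y : hle x y <-> hjoin x y = y.
Proof.
split=> [xy|<-]; last exact: hmeetKU.
by rewrite -xy hjoinC hmeetC hjoinKI.
Qed.

Lemma hle_join z x y : hle (hjoin x y) z <-> hle x z /\ hle y z.
Proof.
split=> [h|[/hle_joinE xz /hle_joinE yz]].
  by split; apply: hle_trans h; rewrite /hle ?hmeetKU // hjoinC hmeetKU.
by apply/hle_joinE; rewrite -hjoinA yz xz.
Qed.

Lemma hle0x x : hle hbot x. Proof. exact: hmeet0x. Qed.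

Lemma hlex1 x : hle x htop. Proof. exact: hmeetx1. Qed.

Lemma hle_imp x y z : hle (hmeet x y) z <-> hle x (himp y z).
Proof. exact: hresid. Qed.

Lemma hlex0 x : hle x hbot -> x = hbot.
Proof. by move=> x0; apply: hle_anti => //; apply: hle0x. Qed.

End HeytingOrder.

Section HeytingOfOrder.
Variables (T : Type) (le : T -> T -> Prop) (meet join imp : T -> T -> T).
Variables (bot top : T).
Hypothesis le_refl : forall x, le x x.
Hypothesis le_trans : forall y x z, le x y -> le y z -> le x z.
Hypothesis le_anti : forall x y, le x y -> le y x -> x = y.
Hypothesis le_meet : forall z x y, le z (meet x y) <-> le z x /\ le z y.
Hypothesis le_join : forall z x y, le (join x y) z <-> le x z /\ le y z.
Hypothesis le0x : forall x, le bot x.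
Hypothesis lex1 : forall x, le x top.
Hypothesis le_imp : forall x y z, le (meet x y) z <-> le x (imp y z).

Lemma order_eq_lower x y : (forall z, le z x <-> le z y) -> x = y.
Proof. by move=> h; apply: le_anti; apply/h. Qed.

Lemma order_eq_upper x y : (forall z, le x z <-> le y z) -> x = y.
Proof. by move=> h; apply: le_anti; apply/h. Qed.

Lemma order_leE x y : meet x y = x <-> le x y.
Proof.
split=> [<-|xy]; first by have /le_meet[] := le_refl (meet x y).
by apply: order_eq_lower => z; rewrite le_meet; split=> [[]//|zx]; eauto.
Qed.

Lemma order_meetC x y : meet x y = meet y x.
Proof. by apply: order_eq_lower => z; rewrite !le_meet; tauto. Qed.

Lemma order_meetA x y t : meet x (meet y t) = meet (meet x y) t.
Proof. by apply: order_eq_lower => z; rewrite !le_meet; tauto. Qed.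

Lemma order_joinC x y : join x y = join y x.
Proof. by apply: order_eq_upper => z; rewrite !le_join; tauto. Qed.

Lemma order_joinA x y t : join x (join y t) = join (join x y) t.
Proof. by apply: order_eq_upper => z; rewrite !le_join; tauto. Qed.

Lemma order_meetKU x y : meet x (join x y) = x.
Proof. by apply/order_leE; have /le_join[] := le_refl (join x y). Qed.

Lemma order_joinKI x y : join x (meet x y) = x.
Proof.
apply: order_eq_upper => z; rewrite le_join; split=> [[]//|xz].
by split=> //; apply: le_trans xz; have /le_meet[] := le_refl (meet x y).
Qed.

Lemma order_meet0x x : meet bot x = bot.
Proof. exact/order_leE. Qed.

Lemma order_meetx1 x : meet x top = x.
Proof. exact/order_leE. Qed.

Lemma order_resid x y z : meet (meet x y) z = meet x y <-> meet x (imp y z) = x.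
Proof. by rewrite !order_leE. Qed.

Definition heyting_of_order : heyting :=
  Heyting order_meetC order_meetA order_joinC order_joinA
    order_meetKU order_joinKI order_meet0x order_meetx1 order_resid.

End HeytingOfOrder.

Section Sum.
Variables A B : heyting.

Definition hsum_car : Type := ({a : A | a <> hbot} + B)%type.

(* The map A -> A + B under which the bottom of A becomes the top of B. *)
Definition hsum_up (a : A) : hsum_car :=
  if pselect (a = hbot) is right nz then inl (exist _ a nz) else inr htop.

Definition hsum_le (x y : hsum_car) : Prop :=
  match x, y with
  | inl a, inl a' => hle (sval a) (sval a')
  | inl _, inr _ => False
  | inr _, inl _ => True
  | inr b, inr b' => hle b b'
  end.

Arguments hsum_le : simpl nomatch.

Definition hsum_meet (x y : hsum_car) : hsum_car :=
  match x, y with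
  | inl a, inl a' => hsum_up (hmeet (sval a) (sval a'))
  | inl _, inr b => inr b
  | inr b, inl _ => inr b
  | inr b, inr b' => inr (hmeet b b')
  end.

Definition hsum_join (x y : hsum_car) : hsum_car :=
  match x, y with
  | inl a, inl a' => hsum_up (hjoin (sval a) (sval a'))
  | inl a, inr _ => inl a
  | inr _, inl a => inl a
  | inr b, inr b' => inr (hjoin b b')
  end.

Definition hsum_imp (x y : hsum_car) : hsum_car :=
  match x, y with
  | inl a, inl a' => hsum_up (himp (sval a) (sval a'))
  | inl a, inr b =>
      if pselect (b = htop) then hsum_up (himp (sval a) hbot) else inr b
  | inr _, inl _ => hsum_up htop
  | inr b, inr b' =>
      if pselect (hle b b') then hsum_up htop else inr (himp b b')
  end.

Lemma hsum_upP (a : A) :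
  (a = hbot /\ hsum_up a = inr htop) \/
  (exists nz : a <> hbot, hsum_up a = inl (exist _ a nz)).
Proof.
by rewrite /hsum_up; case: pselect => [|nz]; [left|right; exists nz].
Qed.

Lemma hsum_le_up (x : {a : A | a <> hbot}) (a : A) :
  hsum_le (inl x) (hsum_up a) <-> hle (sval x) a.
Proof.
case: (hsum_upP a) => [[-> ->]|[nz ->]] //=.
by split=> // /hlex0; case: x.
Qed.

Lemma hsum_leb_up (b : B) (a : A) : hsum_le (inr b) (hsum_up a).
Proof. by case: (hsum_upP a) => [[-> ->]|[nz ->]] //=; apply: hlex1. Qed.

Lemma hsum_up_le (a : A) (x : {a : A | a <> hbot}) :
  hsum_le (hsum_up a) (inl x) <-> hle a (sval x).
Proof.
by case: (hsum_upP a) => [[-> ->]|[nz ->]] //=; split=> // _; apply: hle0x.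
Qed.

Lemma hsum_up_leb (a : A) (b : B) :
  hsum_le (hsum_up a) (inr b) <-> a = hbot /\ b = htop.
Proof.
case: (hsum_upP a) => [[-> ->]|[nz ->]] /=; last by split=> // -[].
split=> [h|[_ ->]]; last exact: hle_refl.
by split=> //; apply: hle_anti h; apply: hlex1.
Qed.

Lemma hsum_le_refl x : hsum_le x x.
Proof. by case: x => x; apply: hle_refl. Qed.

Lemma hsum_le_trans y x z : hsum_le x y -> hsum_le y z -> hsum_le x z.
Proof. by move: y x z; case=> y [] x [] z //=; apply: hle_trans. Qed.

Lemma hsum_le_anti x y : hsum_le x y -> hsum_le y x -> x = y.
Proof.
move: x y => [[x nx]|x] [[y ny]|y] //= xy yx;
  last by congr inr; apply: hle_anti.
have e : x = y by apply: hle_anti.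
by subst y; congr (inl (exist _ _ _)); apply: Prop_irrelevance.
Qed.

Lemma hsum_le_meet z x y :
  hsum_le z (hsum_meet x y) <-> hsum_le z x /\ hsum_le z y.
Proof.
move: z x y => [z|z] [x|x] [y|y] //=; rewrite ?hsum_le_up ?hle_meet; try tauto.
by split=> // _; apply: hsum_leb_up.
Qed.

Lemma hsum_le_join z x y :
  hsum_le (hsum_join x y) z <-> hsum_le x z /\ hsum_le y z.
Proof.
move: z x y => [z|z] [x|x] [y|y] //=; rewrite ?hsum_up_le ?hle_join; try tauto.
rewrite hsum_up_leb; split=> [[h _]|[]//].
by case: x h => x nx /= h; case: nx; apply: hlex0; rewrite -h /hle hmeetKU.
Qed.

Lemma hsum_le0x x : hsum_le (inr hbot) x.
Proof. by case: x => x //=; apply: hle0x. Qed.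

Lemma hsum_lex1 x : hsum_le x (hsum_up htop).
Proof.
by case: x => x; rewrite ?hsum_le_up; [apply: hlex1|apply: hsum_leb_up].
Qed.

Lemma hsum_le_imp x y z :
  hsum_le (hsum_meet x y) z <-> hsum_le x (hsum_imp y z).
Proof.
move: x y z => x [y|y] [z|z] /=.
- case: x => x /=; first by rewrite hsum_up_le hsum_le_up hle_imp.
  by split=> // _; apply: hsum_leb_up.
- case: x => x /=; case: pselect => [zt|nz] //=.
  + rewrite hsum_up_leb hsum_le_up -hle_imp zt; split=> [[-> _]|/hlex0 //].
    exact: hle_refl.
  + by rewrite hsum_up_leb; split=> // -[].
  + by split=> _; [apply: hsum_leb_up|rewrite zt; apply: hlex1].
- case: x => x /=; first by rewrite hsum_le_up; split=> // _; apply: hlex1.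
  by split=> // _; apply: hsum_leb_up.
- case: x => x /=; case: pselect => [yz|nyz] //=.
  + by rewrite hsum_le_up; split=> // _; apply: hlex1.
  + split=> _; first exact: hsum_leb_up.
    by apply: hle_trans yz; have /hle_meet[] := hle_refl (hmeet x y).
  + exact: hle_imp.
Qed.

Definition hsum : heyting :=
  heyting_of_order hsum_le_refl hsum_le_trans hsum_le_anti hsum_le_meet
    hsum_le_join hsum_le0x hsum_lex1 hsum_le_imp.

End Sum.

Inductive term : Type :=
  | Var of nat
  | Bot
  | Top
  | Meet of term & term
  | Join of term & term
  | Imp of term & term.

Fixpoint eval (A : heyting) (v : nat -> A) (t : term) : A :=
  match t with
  | Var n => v n
  | Bot => hbot
  | Top => htop
  | Meet s t => hmeet (eval v s) (eval v t)
  | Join s t => hjoin (eval v s) (eval v t)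
  | Imp s t => himp (eval v s) (eval v t)
  end.

Definition satisfies (A : heyting) (s t : term) : Prop :=
  forall v : nat -> A, eval v s = eval v t.

(* Classes of algebras are written [heyting -> Prop] and not [set heyting]:
   the latter would force the universe of [set] strictly above that of the
   carriers, so that [set X] could never be the carrier of an algebra. *)
Definition variety (K : heyting -> Prop) : Prop :=
  exists E : term -> term -> Prop,
    forall A, K A <-> forall s t, E s t -> satisfies A s t.

Definition generated_variety (C : heyting -> Prop) (A : heyting) : Prop :=
  forall V : heyting -> Prop, variety V -> (forall B, C B -> V B) -> V A.

Lemma variety_generated (C : heyting -> Prop) : variety (generated_variety C).
Proof.
exists (fun s t => forall B, C B -> satisfies B s t) => A; split.
  move=> VA s t Cst; suff /(_ s t): forall s' t', s' = s /\ t' = t ->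
    satisfies A s' t' by apply.
  apply: (VA (fun A' => forall s' t', s' = s /\ t' = t ->
    satisfies A' s' t')) => [|B CB _ _ [-> ->]]; last exact: Cst.
  by exists (fun s' t' => s' = s /\ t' = t).
by move=> h V [E VE] CV; apply/VE => s t st; apply: h => B /CV/VE; apply.
Qed.

Definition subuniverse (A : heyting) (X : set A) : Prop :=
  [/\ X hbot, X htop,
      forall x y, X x -> X y -> X (hmeet x y),
      forall x y, X x -> X y -> X (hjoin x y) &
      forall x y, X x -> X y -> X (himp x y)].

Definition generated_by (A : heyting) (X : set A) : Prop :=
  smallest (@subuniverse A) X = setT.

Definition one_generated (A : heyting) : Prop :=
  exists a : A, generated_by [set a].

Definition finitely_generated (A : heyting) : Prop :=
  exists2 X : set A, finite_set X & generated_by X.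

Definition locally_finite (K : heyting -> Prop) : Prop :=
  forall A, K A -> finitely_generated A -> finite_set [set: A].

(* The sums A_1 + ... + A_n, n >= 1, bracketed to the right, so that A_1 is on
   top; the sum is associative up to isomorphism. *)
Inductive one_generated_sum : heyting -> Prop :=
  | one_generated_sum1 A : one_generated A -> one_generated_sum A
  | one_generated_sumS A B : one_generated A -> one_generated_sum B ->
      one_generated_sum (hsum A B).

Definition KG : heyting -> Prop := generated_variety one_generated_sum.

Definition hom (A B : heyting) (f : A -> B) : Prop :=
  [/\ f hbot = hbot, f htop = htop,
      forall x y, f (hmeet x y) = hmeet (f x) (f y),
      forall x y, f (hjoin x y) = hjoin (f x) (f y) &
      forall x y, f (himp x y) = himp (f x) (f y)].

Definition epimorphism (K : heyting -> Prop) (A B : heyting) (f : A -> B) :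
    Prop :=
  hom f /\
  forall C, K C -> forall g h : B -> C, hom g -> hom h ->
    g \o f = h \o f -> g = h.

Definition ES_property (K : heyting -> Prop) : Prop :=
  forall A B, K A -> K B -> forall f : A -> B, epimorphism K f ->
    forall b, exists a, f a = b.

(* Main.v *)
From mathcomp Require Import all_boot.
From mathcomp Require Import boolp classical_sets functions cardinality.
From mathcomp Require Import zify.
Require Import Defs.

Set Implicit Arguments.
Unset Strict Implicit.
Unset Printing Implicit Defensive.

Local Open Scope classical_set_scope.

(** Consider the incomparability graph of the elements of an algebra. In a sum of
    one-generated algebras it has no triangle and all degrees are at most 3:
    incomparable elements lie in one summand, where they are Rieger-Nishimura
    polynomials of the generator. Both properties are positive disjunctions, so
    they pass to the well-connected members of KG.

    If the geodesics of these graphs are bounded, over all well-connected members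
    of K, then so are the connected components. A component together with its
    meet and its join is an interval between two elements comparable to
    everything, and any union of such intervals containing 0 and 1 is a
    subalgebra. Hence the k-generated well-connected members of K have bounded
    size, and K is locally finite.

    If there are arbitrarily long geodesics, the degree bound forces each of them
    to be a piece of a Rieger-Nishimura ladder, so K contains the algebra of an
    infinite ascending ladder. There the chain of upsets [{j | 2 k <= j}] is a
    proper subalgebra. Two homomorphisms to an algebra without 3-antichains that
    agree on it and differ somewhere must, at some level, interchange the two
    complements in the interval between consecutive members of the chain; this is
    impossible because the ladder is not symmetric. So the inclusion of the chain
    is a non-surjective epimorphism of K. *)

(** * Heyting algebra preliminaries *)

Section HeytingBasics.
Variable A : heyting.
Implicit Types x y z w : A.

Definition hcomparable x y : Prop := hle x y \/ hle y x.

Lemma hcomparable_sym x y : hcomparable x y -> hcomparable y x.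
Proof. by case; [right|left]. Qed.

Lemma hle_meetl x y : hle (hmeet x y) x.
Proof. by have /hle_meet[] := hle_refl (hmeet x y). Qed.

Lemma hle_meetr x y : hle (hmeet x y) y.
Proof. by have /hle_meet[] := hle_refl (hmeet x y). Qed.

Lemma hle_joinl x y : hle x (hjoin x y).
Proof. by have /hle_join[] := hle_refl (hjoin x y). Qed.

Lemma hle_joinr x y : hle y (hjoin x y).
Proof. by have /hle_join[] := hle_refl (hjoin x y). Qed.

Lemma hle_meetI z x y : hle z x -> hle z y -> hle z (hmeet x y).
Proof. by move=> ? ?; apply/hle_meet. Qed.

Lemma hle_joinI z x y : hle x z -> hle y z -> hle (hjoin x y) z.
Proof. by move=> ? ?; apply/hle_join. Qed.

Lemma hle_top x : hle htop x -> x = htop.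
Proof. by move=> h; apply: hle_anti => //; apply: hlex1. Qed.

Lemma hmeet_l x y : hle x y -> hmeet x y = x.
Proof. by []. Qed.

Lemma hmeet_r x y : hle y x -> hmeet x y = y.
Proof. by rewrite hmeetC. Qed.

Lemma hjoin_r x y : hle x y -> hjoin x y = y.
Proof. by move/hle_joinE. Qed.

Lemma hjoin_l x y : hle y x -> hjoin x y = x.
Proof. by rewrite hjoinC; apply: hjoin_r. Qed.

Lemma hle_impI x y z : hle (hmeet x y) z -> hle x (himp y z).
Proof. by move/hle_imp. Qed.

Lemma himp_mp x y : hle (hmeet x (himp x y)) y.
Proof. by rewrite hmeetC; apply/hle_imp/hle_refl. Qed.

Lemma hle_himp x y : hle y (himp x y).
Proof. by apply/hle_imp/hle_meetl. Qed.

Lemma himp_top x y : himp x y = htop <-> hle x y.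
Proof.
split=> [h|xy].
  by have := himp_mp x y; rewrite h hmeetx1.
by apply: hle_top; apply/hle_imp; apply: hle_trans (hle_meetr _ _) xy.
Qed.

Lemma hmeetDr x y z : hmeet x (hjoin y z) = hjoin (hmeet x y) (hmeet x z).
Proof.
apply: hle_anti.
  rewrite hmeetC; apply/hle_imp/hle_joinI; apply/hle_imp; rewrite hmeetC.
    exact: hle_joinl.
  exact: hle_joinr.
apply: hle_joinI; apply: hle_meetI; rewrite ?(hle_meetl _ _) //;
  try exact: hle_meetl.
- exact: hle_trans (hle_meetr _ _) (hle_joinl _ _).
- exact: hle_trans (hle_meetr _ _) (hle_joinr _ _).
Qed.

Lemma himp_joinl x y z : himp (hjoin x y) z = hmeet (himp x z) (himp y z).
Proof.
apply: hle_anti.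
  apply: hle_meetI; apply: hle_impI; rewrite hmeetC.
    apply: hle_trans (himp_mp (hjoin x y) z); apply: hle_meetI (hle_meetr _ _).
    exact: hle_trans (hle_meetl _ _) (hle_joinl _ _).
  apply: hle_trans (himp_mp (hjoin x y) z); apply: hle_meetI (hle_meetr _ _).
  exact: hle_trans (hle_meetl _ _) (hle_joinr _ _).
apply: hle_impI; rewrite hmeetDr; apply: hle_joinI; apply/hle_imp.
  exact: hle_meetl.
exact: hle_meetr.
Qed.

Lemma himp_curry x y z : himp x (himp y z) = himp (hmeet x y) z.
Proof.
apply: hle_anti.
  apply: hle_impI; rewrite hmeetA; apply/hle_imp/hle_imp/hle_refl.
by do 2!apply: hle_impI; rewrite -hmeetA; apply/hle_imp/hle_refl.
Qed.

(** Relativisation: below [q], implication depends only on the parts of its arguments below [q].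
    Thus the elements below [q] form a Heyting algebra with implication [hmeet q (himp x y)]. *)
Lemma himp_meetE q x y :
  hmeet q (himp x y) = hmeet q (himp (hmeet q x) (hmeet q y)).
Proof.
apply: hle_anti; apply: hle_meetI (hle_meetl _ _) _.
  apply: hle_impI; apply: hle_meetI.
    exact: hle_trans (hle_meetl _ _) (hle_meetl _ _).
  apply: hle_trans (himp_mp x y); apply: hle_meetI.
    exact: hle_trans (hle_meetr _ _) (hle_meetr _ _).
  exact: hle_trans (hle_meetl _ _) (hle_meetr _ _).
apply: hle_impI; apply: hle_trans (hle_meetr q y).
apply: hle_trans (himp_mp (hmeet q x) _); apply: hle_meetI.
  apply: hle_meetI (hle_meetr _ _).
  exact: hle_trans (hle_meetl _ _) (hle_meetl _ _).
exact: hle_trans (hle_meetl _ _) (hle_meetr _ _).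
Qed.

End HeytingBasics.

Definition no_3antichain (A : heyting) : Prop :=
  forall x y z : A, [\/ hcomparable x y, hcomparable x z | hcomparable y z].

Definition incomparability_degree3 (A : heyting) : Prop :=
  forall x y1 y2 y3 y4 : A,
    [\/ hcomparable x y1, hcomparable x y2, hcomparable x y3 | hcomparable x y4] \/
    ([\/ y1 = y2, y1 = y3 | y1 = y4] \/ [\/ y2 = y3, y2 = y4 | y3 = y4]).

(** * One-generated algebras *)

Section Ladder.
Variables (A : heyting) (a : A).

(* The pairs (d n, e n) run through the Rieger-Nishimura polynomials of [a]. *)
Fixpoint ladder (n : nat) : A * A :=
  if n is m.+1 then
    (hjoin (ladder m).1 (ladder m).2, himp (ladder m).2 (ladder m).1)
  else (hbot, a).

Local Notation d n := (ladder n).1.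
Local Notation e n := (ladder n).2.

Lemma ladder_dd m n : m <= n -> hle (d m) (d n).
Proof.
elim: n => [|n IH]; first by rewrite leqn0 => /eqP->; apply: hle_refl.
rewrite leq_eqVlt => /orP[/eqP->|/IH h]; first exact: hle_refl.
exact: hle_trans h (hle_joinl _ _).
Qed.

Lemma ladder_ed m n : m < n -> hle (e m) (d n).
Proof. by move=> mn; apply: hle_trans (ladder_dd mn); apply: hle_joinr. Qed.

Lemma ladder_de m n : m < n -> hle (d m) (e n).
Proof.
case: n => // n mn; apply: hle_trans (hle_himp _ _); exact: ladder_dd.
Qed.

Lemma ladder_ee m n : m.+1 < n -> hle (e m) (e n).
Proof. by move=> mn; apply: hle_trans (ladder_de mn); apply: ladder_ed. Qed.

Definition ladder_elt (i : bool * nat) : A := if i.1 then e i.2 else d i.2.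

(** Only an upper bound: in a proper quotient of the Rieger-Nishimura lattice some of these pairs
    become comparable. The graph is a path with pendant vertices, so it has no triangle and degree
    at most 3. *)
Definition ladder_incomparable (i j : bool * nat) : bool :=
  match i, j with
  | (true, m), (true, n) => (m == n.+1) || (n == m.+1)
  | (false, _), (false, _) => false
  | (_, m), (_, n) => m == n
  end.

Lemma ladder_incomparableP i j :
  hcomparable (ladder_elt i) (ladder_elt j) \/ ladder_incomparable i j.
Proof.
case: i j => [[] m] [[] n]; rewrite /ladder_elt /=.
- case: (ltngtP m n) => [mn|nm|->]; last by left; left; apply: hle_refl.
    move: mn; rewrite leq_eqVlt => /orP[/eqP<-|mn].
      by right; rewrite eqxx orbT.
    by left; left; apply: ladder_ee.
  move: nm; rewrite leq_eqVlt => /orP[/eqP<-|mn]; first by right; rewrite eqxx.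
  by left; right; apply: ladder_ee.
- case: (ltngtP m n) => [mn|nm|->]; last by right.
    by left; left; apply: ladder_ed.
  by left; right; apply: ladder_de.
- case: (ltngtP m n) => [mn|nm|->]; last by right.
    by left; left; apply: ladder_de.
  by left; right; apply: ladder_ed.
- case: (leqP m n) => [mn|nm]; left; first by left; apply: ladder_dd.
  by right; apply: ladder_dd; apply: ltnW.
Qed.

Definition ladder_set : set A :=
  [set x | x = htop \/ exists i, x = ladder_elt i].

Lemma ladder_set_d n : ladder_set (d n).
Proof. by right; exists (false, n). Qed.

Lemma ladder_set_e n : ladder_set (e n).
Proof. by right; exists (true, n). Qed.

Lemma ladder_meet_de n : hmeet (d n) (e n) = d n.-1.
Proof.
case: n => [|n] /=; first by rewrite hmeet0x.
rewrite hmeetC hmeetDr (hmeet_r (hle_himp _ _)).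
apply: hjoin_l; rewrite hmeetC; exact: himp_mp.
Qed.

Lemma ladder_meet_ee n : hmeet (e n) (e n.+1) = d n.-1.
Proof.
rewrite -ladder_meet_de; apply: hle_anti; apply: hle_meetI.
- exact: himp_mp.
- exact: hle_meetl.
- exact: hle_meetr.
- exact: hle_trans (hle_meetl _ _) (ladder_de _).
Qed.

Lemma ladder_join_ee n : hjoin (e n) (e n.+1) = d n.+2.
Proof.
apply: hle_anti.
  apply: hle_joinI; [exact: ladder_ed|exact: hle_joinr].
apply: hle_joinI; last exact: hle_joinr.
apply: hle_joinI; last exact: hle_joinl.
apply: hle_trans (hle_joinr _ _); exact: ladder_de.
Qed.

Lemma ladder_set_meet x y :
  ladder_set x -> ladder_set y -> ladder_set (hmeet x y).
Proof.
move=> Sx Sy.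
have cmp : hcomparable x y -> ladder_set (hmeet x y).
  by case=> h; [rewrite hmeet_l|rewrite hmeet_r].
case: (Sx) => [xE|[i xE]]; first by apply: cmp; right; rewrite xE; apply: hlex1.
case: (Sy) => [yE|[j yE]]; first by apply: cmp; left; rewrite yE; apply: hlex1.
have [|] := ladder_incomparableP i j; first by rewrite -xE -yE.
rewrite xE yE; case: i j {xE yE Sx Sy cmp} => [[] m] [[] n] //= h;
  rewrite /ladder_elt /=.
- case/orP: h => /eqP->; [rewrite hmeetC|]; rewrite ladder_meet_ee;
    exact: ladder_set_d.
- rewrite (eqP h) hmeetC ladder_meet_de; exact: ladder_set_d.
- rewrite (eqP h) ladder_meet_de; exact: ladder_set_d.
Qed.

Lemma ladder_set_join x y :
  ladder_set x -> ladder_set y -> ladder_set (hjoin x y).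
Proof.
move=> Sx Sy.
have cmp : hcomparable x y -> ladder_set (hjoin x y).
  by case=> h; [rewrite hjoin_r|rewrite hjoin_l].
case: (Sx) => [xE|[i xE]]; first by apply: cmp; right; rewrite xE; apply: hlex1.
case: (Sy) => [yE|[j yE]]; first by apply: cmp; left; rewrite yE; apply: hlex1.
have [|] := ladder_incomparableP i j; first by rewrite -xE -yE.
rewrite xE yE; case: i j {xE yE Sx Sy cmp} => [[] m] [[] n] //= h;
  rewrite /ladder_elt /=.
- case/orP: h => /eqP->; [rewrite hjoinC|]; rewrite ladder_join_ee;
    exact: ladder_set_d.
- rewrite (eqP h) hjoinC; exact: (ladder_set_d n.+1).
- rewrite (eqP h); exact: (ladder_set_d n.+1).
Qed.

Lemma ladder_himp_e_lt m n : m.+2 < n -> himp (e n) (d m) = d m.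
Proof.
move=> mn; apply: hle_anti; last exact: hle_himp.
set w := himp _ _.
have wn : hle (hmeet w (e n)) (d m) by apply/hle_imp/hle_refl.
(* [e m.+1] is [himp (e m) (d m)], and [e m] lies below [e n]. Since [e m.+1] is below [e n] too,
   [w] is below [e n] and modus ponens applies. *)
have wm : hle w (e m.+1).
  apply/hle_imp; apply: hle_trans wn; apply: hle_meetI; first exact: hle_meetl.
  by apply: hle_trans (hle_meetr _ _) _; apply: ladder_ee; lia.
apply: hle_trans wn; apply: hle_meetI; first exact: hle_refl.
by apply: hle_trans wm _; apply: ladder_ee; lia.
Qed.

Lemma ladder_himp_e2 n : himp (e n.+2) (d n) = e n.+1.
Proof.
apply: hle_anti.
  apply/hle_imp; apply: hle_trans (himp_mp (e n.+2) (d n)).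
  apply: hle_meetI; last exact: hle_meetl.
  by apply: hle_trans (hle_meetr _ _) _; apply: ladder_ee.
apply/hle_imp; rewrite ladder_meet_ee; exact: hle_refl.
Qed.

(** [d n.+1] and [e n.+1] meet in [d n]. The right-hand side is [e n.+2] by definition. *)
Lemma ladder_himp_e1 n : himp (e n.+1) (d n) = himp (e n.+1) (d n.+1).
Proof.
apply: hle_anti; apply/hle_imp.
  rewrite hmeetC; apply: hle_trans (himp_mp _ _) _; exact: ladder_dd.
rewrite -[X in hle _ X](ladder_meet_de n.+1).
by apply: hle_meetI; [rewrite hmeetC; apply: himp_mp|apply: hle_meetr].
Qed.

(** As [n] grows past [m], the value is successively [htop], [e n.+1], [e m.+2], [e m.+1] and
    [d m]. *)
Lemma ladder_set_himp_e m n : ladder_set (himp (e n) (d m)).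
Proof.
case: (ltnP n m) => [nm|]; first by left; apply/himp_top/ladder_ed.
rewrite leq_eqVlt => /orP[/eqP->|]; first exact: (ladder_set_e n.+1).
rewrite leq_eqVlt => /orP[/eqP<-|].
  rewrite ladder_himp_e1; exact: (ladder_set_e m.+2).
rewrite leq_eqVlt => /orP[/eqP<-|mn].
  rewrite ladder_himp_e2; exact: ladder_set_e.
rewrite ladder_himp_e_lt //; exact: ladder_set_d.
Qed.

Lemma ladder_set_himp_d m x : ladder_set x -> ladder_set (himp x (d m)).
Proof.
case=> [->|[[[] n] ->]]; rewrite /ladder_elt /=.
- right; exists (false, m); rewrite /ladder_elt /=.
  apply: hle_anti; last exact: hle_himp.
  have := himp_mp htop (d m); by rewrite hmeet_r //; apply: hlex1.
- exact: ladder_set_himp_e.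
elim: n => [|n IH] /=; first by left; apply/himp_top/hle0x.
rewrite himp_joinl; apply: ladder_set_meet => //; exact: ladder_set_himp_e.
Qed.

Lemma ladder_set_himp x y :
  ladder_set x -> ladder_set y -> ladder_set (himp x y).
Proof.
move=> Sx [->|[[[] m] ->]]; rewrite /ladder_elt /=.
- by left; apply/himp_top/hlex1.
- case: m => [|m] /=.
    have -> : a = d 1 by rewrite /= hjoin_r //; apply: hle0x.
    exact: ladder_set_himp_d.
  (* [e m.+1] is an implication into [d m], so currying leaves the consequent [d m]. *)
  rewrite himp_curry; apply: ladder_set_himp_d; apply: ladder_set_meet => //.
  exact: ladder_set_e.
- exact: ladder_set_himp_d.
Qed.

Lemma ladder_set_subuniverse : subuniverse ladder_set.
Proof.
split; [exact: (ladder_set_d 0)|by left|exact: ladder_set_meet| |].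
- exact: ladder_set_join.
- exact: ladder_set_himp.
Qed.

End Ladder.

Lemma generated_by_ind (A : heyting) (X Y : set A) :
  generated_by X -> subuniverse Y -> X `<=` Y -> forall x, Y x.
Proof.
move=> gX sY XY x; apply: (smallest_sub sY XY).
by rewrite gX.
Qed.

Lemma one_generated_ladder (A : heyting) :
  one_generated A -> exists a : A, forall x, ladder_set a x.
Proof.
move=> [a ga]; exists a; apply: (generated_by_ind ga).
  exact: ladder_set_subuniverse.
move=> _ ->; exact: (ladder_set_e a 0).
Qed.

Lemma hcomparable_topl (A : heyting) (x : A) : hcomparable htop x.
Proof. by right; apply: hlex1. Qed.

Lemma hcomparable_topr (A : heyting) (x : A) : hcomparable x htop.
Proof. by left; apply: hlex1. Qed.

Lemma one_generated_no_3antichain (A : heyting) :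
  one_generated A -> no_3antichain A.
Proof.
move=> /one_generated_ladder[a Sa] x y z.
have [->|[i ->]] := Sa x; first by constructor 1; apply: hcomparable_topl.
have [->|[j ->]] := Sa y; first by constructor 1; apply: hcomparable_topr.
have [->|[k ->]] := Sa z; first by constructor 2; apply: hcomparable_topr.
have [|ij] := ladder_incomparableP a i j; first by constructor 1.
have [|ik] := ladder_incomparableP a i k; first by constructor 2.
have [|jk] := ladder_incomparableP a j k; first by constructor 3.
by move: i j k ij ik jk => [[] i] [[] j] [[] k] /=; lia.
Qed.

Lemma one_generated_degree3 (A : heyting) :
  one_generated A -> incomparability_degree3 A.
Proof.
move=> /one_generated_ladder[a Sa] x y1 y2 y3 y4.
have [->|[i ->]] := Sa x; first by left; constructor 1; apply: hcomparable_topl.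
have [->|[j1 ->]] := Sa y1; first by left; constructor 1; apply: hcomparable_topr.
have [->|[j2 ->]] := Sa y2; first by left; constructor 2; apply: hcomparable_topr.
have [->|[j3 ->]] := Sa y3; first by left; constructor 3; apply: hcomparable_topr.
have [->|[j4 ->]] := Sa y4; first by left; constructor 4; apply: hcomparable_topr.
have [|h1] := ladder_incomparableP a i j1; first by left; constructor 1.
have [|h2] := ladder_incomparableP a i j2; first by left; constructor 2.
have [|h3] := ladder_incomparableP a i j3; first by left; constructor 3.
have [|h4] := ladder_incomparableP a i j4; first by left; constructor 4.
have : [|| j1 == j2, j1 == j3, j1 == j4, j2 == j3, j2 == j4 | j3 == j4].
  move: i j1 j2 j3 j4 h1 h2 h3 h4 => [bi i] [b1 j1] [b2 j2] [b3 j3] [b4 j4].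
  rewrite /= !xpair_eqE.
  by case: bi b1 b2 b3 b4 => [] [] [] [] [] //=; lia.
move=> h; right; move: h.
by do 5?[case/orP=> [/eqP->|]];
  [left; constructor 1|left; constructor 2|left; constructor 3
  |right; constructor 1|right; constructor 2|move/eqP->; right; constructor 3].
Qed.

(** * Ordinal sums *)

Section SumComparability.
Variables A B : heyting.

Lemma hsum_hleE (x y : hsum A B) : hle x y <-> hsum_le x y.
Proof.
exact: (order_leE (@hsum_le_refl A B) (@hsum_le_trans A B)
  (@hsum_le_anti A B) (@hsum_le_meet A B)).
Qed.

Lemma hsum_comparable_inl (x y : {a : A | a <> hbot}) :
  hcomparable (sval x) (sval y) -> hcomparable (inl x : hsum A B) (inl y).
Proof. by case=> h; [left|right]; apply/hsum_hleE. Qed.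

Lemma hsum_comparable_inr (x y : B) :
  hcomparable x y -> hcomparable (inr x : hsum A B) (inr y).
Proof. by case=> h; [left|right]; apply/hsum_hleE. Qed.

Lemma hsum_comparable_inlr (x : {a : A | a <> hbot}) (y : B) :
  hcomparable (inl x : hsum A B) (inr y).
Proof. by right; apply/hsum_hleE. Qed.

Lemma hsum_comparable_inrl (x : B) (y : {a : A | a <> hbot}) :
  hcomparable (inr x : hsum A B) (inl y).
Proof. by left; apply/hsum_hleE. Qed.

Lemma sval_nonbot_inj (x y : {a : A | a <> hbot}) : sval x = sval y -> x = y.
Proof.
case: x y => [x nx] [y ny] /= xy; subst y.
by congr exist; apply: Prop_irrelevance.
Qed.

(** Elements of different summands are comparable, so an antichain lies in one summand. *)
Lemma hsum_no_3antichain :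
  no_3antichain A -> no_3antichain B -> no_3antichain (hsum A B).
Proof.
move=> wA wB [x|x] [y|y] [z|z];
  try (by constructor 1; apply: hsum_comparable_inlr);
  try (by constructor 1; apply: hsum_comparable_inrl);
  try (by constructor 2; apply: hsum_comparable_inlr);
  try (by constructor 2; apply: hsum_comparable_inrl).
- have [h|h|h] := wA (sval x) (sval y) (sval z);
    by [constructor 1; apply: hsum_comparable_inl
       |constructor 2; apply: hsum_comparable_inl
       |constructor 3; apply: hsum_comparable_inl].
- have [h|h|h] := wB x y z;
    by [constructor 1; apply: hsum_comparable_inr
       |constructor 2; apply: hsum_comparable_inr
       |constructor 3; apply: hsum_comparable_inr].
Qed.

Lemma hsum_degree3 :
  incomparability_degree3 A -> incomparability_degree3 B ->
  incomparability_degree3 (hsum A B).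
Proof.
move=> dA dB [x|x] [y1|y1] y2 y3 y4;
  try (by left; constructor 1; apply: hsum_comparable_inlr);
  try (by left; constructor 1; apply: hsum_comparable_inrl);
case: y2 => y2; try (by left; constructor 2; apply: hsum_comparable_inlr);
  try (by left; constructor 2; apply: hsum_comparable_inrl);
case: y3 => y3; try (by left; constructor 3; apply: hsum_comparable_inlr);
  try (by left; constructor 3; apply: hsum_comparable_inrl);
case: y4 => y4; try (by left; constructor 4; apply: hsum_comparable_inlr);
  try (by left; constructor 4; apply: hsum_comparable_inrl).
- have [[] h|[[] /sval_nonbot_inj->|[] /sval_nonbot_inj->]] :=
    dA (sval x) (sval y1) (sval y2) (sval y3) (sval y4).
  + by left; constructor 1; apply: hsum_comparable_inl.
  + by left; constructor 2; apply: hsum_comparable_inl.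
  + by left; constructor 3; apply: hsum_comparable_inl.
  + by left; constructor 4; apply: hsum_comparable_inl.
  + by right; left; constructor 1.
  + by right; left; constructor 2.
  + by right; left; constructor 3.
  + by right; right; constructor 1.
  + by right; right; constructor 2.
  + by right; right; constructor 3.
- have [[] h|[[] ->|[] ->]] := dB x y1 y2 y3 y4.
  + by left; constructor 1; apply: hsum_comparable_inr.
  + by left; constructor 2; apply: hsum_comparable_inr.
  + by left; constructor 3; apply: hsum_comparable_inr.
  + by left; constructor 4; apply: hsum_comparable_inr.
  + by right; left; constructor 1.
  + by right; left; constructor 2.
  + by right; left; constructor 3.
  + by right; right; constructor 1.
  + by right; right; constructor 2.
  + by right; right; constructor 3.
Qed.

End SumComparability.

Lemma one_generated_sum_no_3antichain (A : heyting) :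
  one_generated_sum A -> no_3antichain A.
Proof.
elim=> {A} [A|A B gA _ IH]; first exact: one_generated_no_3antichain.
by apply: hsum_no_3antichain => //; apply: one_generated_no_3antichain.
Qed.

Lemma one_generated_sum_degree3 (A : heyting) :
  one_generated_sum A -> incomparability_degree3 A.
Proof.
elim=> {A} [A|A B gA _ IH]; first exact: one_generated_degree3.
by apply: hsum_degree3 => //; apply: one_generated_degree3.
Qed.

(** * Well-connected members of a generated variety *)

Definition well_connected (A : heyting) : Prop :=
  (hbot : A) <> htop /\
  forall x y : A, hjoin x y = htop -> x = htop \/ y = htop.

Fixpoint holds_some (A : heyting) (v : nat -> A) (us : seq term) : Prop :=
  if us is u :: us' then eval v u = htop \/ holds_some v us' else False.

(* An elementary substitute for Jonsson's lemma: a positive disjunction valid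
   in the generators becomes an equation between joins, which splits again in
   well-connected members of the variety. *)
Lemma well_connected_transfer (C : heyting -> Prop) (us : seq term) :
  (forall B, C B -> forall v : nat -> B, holds_some v us) ->
  forall A, generated_variety C A -> well_connected A ->
  forall v : nat -> A, holds_some v us.
Proof.
move=> Cus A gA [A01 wcA] v.
suff : eval v (foldr Join Bot us) = htop.
  by elim: (us) => //= u us' IH /wcA[]; [left|right; apply: IH].
have vV : variety (fun B => satisfies B (foldr Join Bot us) Top).
  exists (fun s t => s = foldr Join Bot us /\ t = Top) => B.
  by split=> [h _ _ [-> ->]|]; [|apply].
apply: (gA _ vV) => B CB w.
move: (Cus _ CB w) => {vV Cus}; elim: us => //= u us IH [->|/IH ->].
  by rewrite hjoin_l //; apply: hlex1.
by rewrite hjoin_r //; apply: hlex1.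
Qed.

Definition TIff (s t : term) : term := Meet (Imp s t) (Imp t s).

Lemma eval_TIff (A : heyting) (v : nat -> A) (s t : term) :
  eval v (TIff s t) = htop <-> eval v s = eval v t.
Proof.
split=> /= [h|->]; last first.
  by have /himp_top -> := hle_refl (eval v t); rewrite hmeetx1.
apply: hle_anti; apply/himp_top/hle_top; rewrite -h;
  [exact: hle_meetl|exact: hle_meetr].
Qed.

(** Two elements are comparable when one of the implications between them is [htop], so the property
    is a positive disjunction and [well_connected_transfer] applies. *)
Lemma KG_no_3antichain (A : heyting) :
  KG A -> well_connected A -> no_3antichain A.
Proof.
move=> KA wA x y z.
pose p i j := [:: Imp (Var i) (Var j); Imp (Var j) (Var i)].
have : holds_some (nth hbot [:: x; y; z]) (p 0 1 ++ p 0 2 ++ p 1 2).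
  apply: well_connected_transfer KA wA _ => B gB v; rewrite /= !himp_top.
  by have [[]|[]|[]] := one_generated_sum_no_3antichain gB (v 0) (v 1) (v 2);
    tauto.
rewrite /= !himp_top => -[h|[h|[h|[h|[h|[h|//]]]]]].
- by constructor 1; left.
- by constructor 1; right.
- by constructor 2; left.
- by constructor 2; right.
- by constructor 3; left.
- by constructor 3; right.
Qed.

Lemma KG_degree3 (A : heyting) :
  KG A -> well_connected A -> incomparability_degree3 A.
Proof.
move=> KA wA x y1 y2 y3 y4.
pose p i := [:: Imp (Var 0) (Var i); Imp (Var i) (Var 0)].
pose q i j := [:: TIff (Var i) (Var j)].
have : holds_some (nth hbot [:: x; y1; y2; y3; y4])
  (p 1 ++ p 2 ++ p 3 ++ p 4 ++ q 1 2 ++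
   q 1 3 ++ q 1 4 ++ q 2 3 ++ q 2 4 ++ q 3 4).
  apply: well_connected_transfer KA wA _ => B gB v.
  rewrite /p /q !cat_cons !cat0s /holds_some !eval_TIff /= !himp_top.
  by have [[[]|[]|[]|[]]|[[]|[]]] :=
    one_generated_sum_degree3 gB (v 0) (v 1) (v 2) (v 3) (v 4); tauto.
rewrite /p /q !cat_cons !cat0s /holds_some !eval_TIff /= !himp_top.
move=> [h|[h|[h|[h|[h|[h|[h|[h|[h|[h|[h|[h|[h|[h|//]]]]]]]]]]]]]].
- by left; constructor 1; left.
- by left; constructor 1; right.
- by left; constructor 2; left.
- by left; constructor 2; right.
- by left; constructor 3; left.
- by left; constructor 3; right.
- by left; constructor 4; left.
- by left; constructor 4; right.
- by right; left; constructor 1.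
- by right; left; constructor 2.
- by right; left; constructor 3.
- by right; right; constructor 1.
- by right; right; constructor 2.
- by right; right; constructor 3.
Qed.

(** * Homomorphisms, subalgebras and quotients *)

Section Homomorphisms.
Variables (A B : heyting) (f : A -> B).
Hypothesis homf : hom f.

Lemma hom_eval (v : nat -> A) (t : term) : f (eval v t) = eval (f \o v) t.
Proof.
case: homf => f0 f1 fI fU fM.
by elim: t => //= [s <- t <-|s <- t <-|s <- t <-].
Qed.

Lemma hom_hle (x y : A) : hle x y -> hle (f x) (f y).
Proof. by case: homf => _ _ fI _ _; rewrite /hle -fI => ->. Qed.

(** If [f x] were below [f y], then [f] would send [himp x y], hence also [u], to [htop]. *)
Lemma hom_nhle (u x y : A) : f u <> htop -> hle (himp x y) u ->
  ~ hle (f x) (f y).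
Proof.
case: homf => f0 f1 fI fU fM fu /hom_hle xyu /himp_top fxy; apply: fu.
by apply: hle_top; rewrite -fxy -fM.
Qed.

Lemma variety_surj (K : heyting -> Prop) :
  variety K -> (forall b, exists a, f a = b) -> K A -> K B.
Proof.
move=> [E KE] surj /KE KA; apply/KE => s t /KA st v.
have [w fw] := choice surj.
have -> : v = f \o (w \o v) by apply/funext => n /=; rewrite fw.
by rewrite -!hom_eval st.
Qed.

Lemma variety_inj (K : heyting -> Prop) :
  variety K -> injective f -> K B -> K A.
Proof.
move=> [E KE] injf /KE KB; apply/KE => s t /KB st v.
by apply: injf; rewrite !hom_eval.
Qed.

End Homomorphisms.

Lemma hom_comp (A B C : heyting) (f : A -> B) (g : B -> C) :
  hom f -> hom g -> hom (g \o f).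
Proof.
move=> [f0 f1 fI fU fM] [g0 g1 gI gU gM].
by split=> [||x y|x y|x y] /=; rewrite (f0, f1, fI, fU, fM).
Qed.

Section Subalgebra.
Variables (A : heyting) (X : set A).
Hypothesis subX : subuniverse X.

Definition sub_car : Type := {x : A | X x}.

Lemma sub_car_inj (x y : sub_car) : sval x = sval y -> x = y.
Proof.
case: x y => [x Xx] [y Xy] /= xy; subst y.
by congr exist; apply: Prop_irrelevance.
Qed.

Let X0 : X hbot. Proof. by case: subX. Qed.
Let X1 : X htop. Proof. by case: subX. Qed.
Let XI x y : X x -> X y -> X (hmeet x y).
Proof. by case: subX => _ _ h _ _; apply: h. Qed.
Let XU x y : X x -> X y -> X (hjoin x y).
Proof. by case: subX => _ _ _ h _; apply: h. Qed.
Let XM x y : X x -> X y -> X (himp x y).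
Proof. by case: subX => _ _ _ _ h; apply: h. Qed.

Definition sub_meet (x y : sub_car) : sub_car :=
  exist _ (hmeet (sval x) (sval y)) (XI (svalP x) (svalP y)).
Definition sub_join (x y : sub_car) : sub_car :=
  exist _ (hjoin (sval x) (sval y)) (XU (svalP x) (svalP y)).
Definition sub_imp (x y : sub_car) : sub_car :=
  exist _ (himp (sval x) (sval y)) (XM (svalP x) (svalP y)).

Definition subalgebra : heyting.
Proof.
refine (@Heyting sub_car sub_meet sub_join sub_imp (exist _ hbot X0)
  (exist _ htop X1) _ _ _ _ _ _ _ _ _).
- by move=> x y; apply: sub_car_inj; apply: hmeetC.
- by move=> x y z; apply: sub_car_inj; apply: hmeetA.
- by move=> x y; apply: sub_car_inj; apply: hjoinC.
- by move=> x y z; apply: sub_car_inj; apply: hjoinA.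
- by move=> x y; apply: sub_car_inj; apply: hmeetKU.
- by move=> x y; apply: sub_car_inj; apply: hjoinKI.
- by move=> x; apply: sub_car_inj; apply: hmeet0x.
- by move=> x; apply: sub_car_inj; apply: hmeetx1.
- move=> x y z; split=> /(congr1 sval) /= h; apply: sub_car_inj.
    exact/hresid.
  exact/(hresid (sval x)).
Defined.

Lemma subalgebra_hom : @hom subalgebra A (fun x => sval x).
Proof. by []. Qed.

End Subalgebra.

Section Quotient.
Variables (A : heyting) (F : set A).
Hypothesis F1 : F htop.
Hypothesis Fup : forall x y, F x -> hle x y -> F y.
Hypothesis FI : forall x y, F x -> F y -> F (hmeet x y).

Let Frefl x : F (himp x x).
Proof. by have /himp_top-> := hle_refl x. Qed.

Let Fle x y : hle x y -> F (himp x y).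
Proof. by move=> /himp_top ->. Qed.

Let Ftrans y x z : F (himp x y) -> F (himp y z) -> F (himp x z).
Proof.
move=> xy yz; apply: Fup (FI xy yz) _; apply: hle_impI.
apply: hle_trans (himp_mp y z); apply: hle_meetI; last first.
  exact: hle_trans (hle_meetl _ _) (hle_meetr _ _).
apply: hle_trans (himp_mp x y); apply: hle_meetI; first exact: hle_meetr.
exact: hle_trans (hle_meetl _ _) (hle_meetl _ _).
Qed.

Let Fmeet z x y : F (himp z (hmeet x y)) <-> F (himp z x) /\ F (himp z y).
Proof.
split=> [h|[zx zy]].
  split; apply: Ftrans h _; apply: Fle; [exact: hle_meetl|exact: hle_meetr].
apply: Fup (FI zx zy) _; apply: hle_impI; apply: hle_meetI.
  apply: hle_trans (himp_mp z x); apply: hle_meetI; first exact: hle_meetr.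
  exact: hle_trans (hle_meetl _ _) (hle_meetl _ _).
apply: hle_trans (himp_mp z y); apply: hle_meetI; first exact: hle_meetr.
exact: hle_trans (hle_meetl _ _) (hle_meetr _ _).
Qed.

Let Fjoin z x y : F (himp (hjoin x y) z) <-> F (himp x z) /\ F (himp y z).
Proof.
rewrite himp_joinl; split=> [h|[]]; last exact: FI.
split; apply: Fup h _; [exact: hle_meetl|exact: hle_meetr].
Qed.

Definition quo_class (x : A) : set A :=
  [set y | F (himp x y) /\ F (himp y x)].

Definition quo_car : Type := {P : set A | exists x, P = quo_class x}.

Definition quo_pi (x : A) : quo_car := exist _ (quo_class x) (ex_intro _ x erefl).

(** Order and operations of the quotient are taken on chosen representatives; they agree with those
    of [A] up to implications in [F]. *)
Definition quo_repr (P : quo_car) : A := projT1 (cid (svalP P)).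

Definition quo_le (P Q : quo_car) : Prop := F (himp (quo_repr P) (quo_repr Q)).

Lemma quo_car_inj (P Q : quo_car) : sval P = sval Q -> P = Q.
Proof.
case: P Q => [P HP] [Q HQ] /= PQ; subst Q.
by congr exist; apply: Prop_irrelevance.
Qed.

Lemma quo_reprK (P : quo_car) : quo_pi (quo_repr P) = P.
Proof.
apply: quo_car_inj; rewrite /= /quo_repr; case: cid => x /= ->.
by [].
Qed.

Lemma quo_pi_repr x : F (himp x (quo_repr (quo_pi x))) /\
  F (himp (quo_repr (quo_pi x)) x).
Proof.
rewrite /quo_repr; case: cid => y /= xy.
have : quo_class y y by split; apply: Frefl.
by rewrite -xy.
Qed.

Lemma quo_le_pi (P : quo_car) x : quo_le P (quo_pi x) <-> F (himp (quo_repr P) x).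
Proof.
have [h1 h2] := quo_pi_repr x.
by split=> h; [apply: Ftrans h h2|apply: Ftrans h h1].
Qed.

Lemma quo_pi_le (P : quo_car) x : quo_le (quo_pi x) P <-> F (himp x (quo_repr P)).
Proof.
have [h1 h2] := quo_pi_repr x.
by split=> h; [apply: Ftrans h1 h|apply: Ftrans h2 h].
Qed.

Lemma quo_pi_le_pi x y : quo_le (quo_pi x) (quo_pi y) <-> F (himp x y).
Proof.
rewrite quo_le_pi; have [h1 h2] := quo_pi_repr x.
by split=> h; [apply: Ftrans h1 h|apply: Ftrans h2 h].
Qed.

Lemma quo_le_refl P : quo_le P P.
Proof. exact: Frefl. Qed.

Lemma quo_le_trans Q P R : quo_le P Q -> quo_le Q R -> quo_le P R.
Proof. exact: Ftrans. Qed.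

Lemma quo_le_anti P Q : quo_le P Q -> quo_le Q P -> P = Q.
Proof.
move=> PQ QP; rewrite -[P]quo_reprK -[Q]quo_reprK.
apply: quo_car_inj; apply/funext => z /=; apply/propext.
split=> -[h1 h2]; split; [exact: Ftrans QP h1|exact: Ftrans h2 PQ
  |exact: Ftrans PQ h1|exact: Ftrans h2 QP].
Qed.

Definition quo_op (op : A -> A -> A) (P Q : quo_car) : quo_car :=
  quo_pi (op (quo_repr P) (quo_repr Q)).

Lemma quo_le_meet R P Q :
  quo_le R (quo_op (@hmeet A) P Q) <-> quo_le R P /\ quo_le R Q.
Proof. by rewrite quo_le_pi Fmeet. Qed.

Lemma quo_le_join R P Q :
  quo_le (quo_op (@hjoin A) P Q) R <-> quo_le P R /\ quo_le Q R.
Proof. by rewrite quo_pi_le Fjoin. Qed.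

Lemma quo_le0x P : quo_le (quo_pi hbot) P.
Proof. by rewrite quo_pi_le; apply: Fle; apply: hle0x. Qed.

Lemma quo_lex1 P : quo_le P (quo_pi htop).
Proof. by rewrite quo_le_pi; apply: Fle; apply: hlex1. Qed.

Lemma quo_le_imp P Q R :
  quo_le (quo_op (@hmeet A) P Q) R <-> quo_le P (quo_op (@himp A) Q R).
Proof. by rewrite quo_pi_le quo_le_pi himp_curry. Qed.

Definition quotient : heyting :=
  heyting_of_order quo_le_refl quo_le_trans quo_le_anti quo_le_meet
    quo_le_join quo_le0x quo_lex1 quo_le_imp.

Lemma quotient_hleE (P Q : quotient) : hle P Q <-> quo_le P Q.
Proof. exact: (order_leE quo_le_refl quo_le_trans quo_le_anti quo_le_meet). Qed.

Lemma quotient_hle (x y : A) :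
  hle (quo_pi x : quotient) (quo_pi y) <-> F (himp x y).
Proof. by rewrite quotient_hleE quo_pi_le_pi. Qed.

Lemma quotient_hom : @hom A quotient quo_pi.
Proof.
have piI x y : quo_pi (hmeet x y) = hmeet (quo_pi x : quotient) (quo_pi y).
  apply: (order_eq_lower quo_le_refl quo_le_anti) => P.
  by rewrite quo_le_meet !quo_le_pi Fmeet.
split=> //.
- move=> x y; apply: (order_eq_upper quo_le_refl quo_le_anti) => P.
  by rewrite quo_le_join !quo_pi_le Fjoin.
- move=> x y; apply: (order_eq_lower quo_le_refl quo_le_anti) => P.
  rewrite -quo_le_imp -[P]quo_reprK.
  have -> : quo_op (@hmeet A) (quo_pi (quo_repr P)) (quo_pi x) =
    quo_pi (hmeet (quo_repr P) x) by rewrite piI.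
  by rewrite !quo_pi_le_pi himp_curry.
Qed.

Lemma quotient_surj (P : quotient) : exists x, quo_pi x = P.
Proof. by exists (quo_repr P); apply: quo_reprK. Qed.

Lemma quotient_top (x : A) : (quo_pi x : quotient) = htop <-> F x.
Proof.
split=> [h|Fx].
  have /quotient_hle : hle (quo_pi htop : quotient) (quo_pi x).
    by rewrite h; apply: hle_refl.
  by move=> h1; apply: Fup h1 _; have := himp_mp htop x; rewrite hmeet_r //;
    apply: hlex1.
apply: hle_top; apply/quotient_hle; apply: Fup Fx _; exact: hle_himp.
Qed.

Lemma quotient_well_connected : ~ F hbot ->
  (forall x y, F (hjoin x y) -> F x \/ F y) -> well_connected quotient.
Proof.
move=> F0 FU; split=> [h|P Q].
  by apply: F0; apply/quotient_top; rewrite -h.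
have [x <-] := quotient_surj P; have [y <-] := quotient_surj Q.
have [_ _ _ <- _] := quotient_hom.
by move=> /quotient_top/FU[] /quotient_top; [left|right].
Qed.

End Quotient.

(** * Prime filters and separation by well-connected quotients *)

Lemma prime_filter_separation (A : heyting) (x y : A) : ~ hle x y ->
  exists F : set A, [/\ F x, ~ F y, forall a b, F a -> hle a b -> F b,
    forall a b, F a -> F b -> F (hmeet a b) &
    forall a b, F (hjoin a b) -> F a \/ F b].
Proof.
move=> nxy.
(* The third clause says that adjoining [x] does not bring in [y]. The empty set satisfies [P], as
   the empty chain in Zorn's lemma demands; hence the alternative [f = htop] in [Fext]. *)
pose P (F : set A) := [/\ forall a b, F a -> hle a b -> F b,
  forall a b, F a -> F b -> F (hmeet a b) &
  forall a, F a -> ~ hle (hmeet x a) y].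
have [F [[Fup FI Fy] Fmax]] : exists F, P F /\ forall G, F `<` G -> ~ P G.
  apply: Zorn_bigcup => C CP Ctot; split.
  - by move=> a b [G CG Ga] ab; exists G => //; have [h _ _] := CP _ CG; apply: h ab.
  - move=> a b [G CG Ga] [H CH Hb].
    have [GH|HG] := Ctot _ _ CG CH.
      by exists H => //; have [_ h _] := CP _ CH; apply: h => //; apply: GH.
    by exists G => //; have [_ h _] := CP _ CG; apply: h => //; apply: HG.
  - by move=> a [G CG Ga]; have [_ _ h] := CP _ CG; apply: h.
have Fext a : ~ F a ->
    exists f, (f = htop \/ F f) /\ hle (hmeet x (hmeet f a)) y.
  move=> nFa; apply: contrapT => none.
  (* Otherwise the filter [G] generated by [F] and [a] would satisfy [P] and properly extend [F]. *)
  pose G := [set b | exists2 f, (f = htop \/ F f) & hle (hmeet f a) b].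
  apply: (Fmax G).
    split; last first.
      by move=> GF; apply: nFa; apply: GF; exists htop; [left|apply: hle_meetr].
    by move=> b Fb; exists b; [right|apply: hle_meetl].
  split.
  - by move=> b c [f Ff fb] bc; exists f => //; apply: hle_trans fb bc.
  - move=> b c [f Ff fb] [g Fg gc]; exists (hmeet f g).
      case: Ff Fg => [->|Ff] [->|Fg]; first by left; rewrite hmeetx1.
      + by right; rewrite hmeet_r //; apply: hlex1.
      + by right; rewrite hmeetx1.
      + by right; apply: FI.
    apply: hle_meetI; [apply: hle_trans fb|apply: hle_trans gc];
      (apply: hle_meetI; last exact: hle_meetr);
      apply: hle_trans (hle_meetl _ _) _; [exact: hle_meetl|exact: hle_meetr].
  - move=> b [f Ff fb] xb; apply: none; exists f; split=> //.
    apply: hle_trans xb; apply: hle_meetI; first exact: hle_meetl.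
    exact: hle_trans (hle_meetr _ _) fb.
have F1 : F htop.
  apply: contrapT => /Fext[f [Ff]]; rewrite hmeetx1 => h.
  case: Ff => [fE|/Fy]; last by apply.
  by apply: nxy; move: h; rewrite fE hmeetx1.
have Fx : F x.
  apply: contrapT => /Fext[f [Ff]] h.
  have Ff' : F f by case: Ff => [->|].
  apply: (Fy _ Ff'); apply: hle_trans h; apply: hle_meetI.
    exact: hle_meetl.
  by apply: hle_meetI; [apply: hle_meetr|apply: hle_meetl].
exists F; split=> //; first by move=> /Fy; apply; apply: hle_meetr.
(* By distributivity, the meet of [f], [g] and [hjoin a b] is a member of [F] whose meet with [x]
   lies below [y]. *)
move=> a b Fab; apply: contrapT => /not_orP[/Fext[f [Ff fa]] /Fext[g [Fg gb]]].
have Ff' : F f by case: Ff => [->|].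
have Fg' : F g by case: Fg => [->|].
apply: (Fy _ (FI _ _ (FI _ _ Ff' Fg') Fab)).
rewrite !hmeetDr; apply: hle_joinI; [apply: hle_trans fa|apply: hle_trans gb];
  (apply: hle_meetI; [exact: hle_meetl|apply: hle_trans (hle_meetr _ _) _]);
  (apply: hle_meetI; [apply: hle_trans (hle_meetl _ _) _|exact: hle_meetr]);
  [exact: hle_meetl|exact: hle_meetr].
Qed.

(** Of two distinct elements one is not below the other. The quotient by a prime filter that
    separates them is well-connected because the filter is prime and proper. *)
Lemma well_connected_separation (K : heyting -> Prop) (A : heyting) (x y : A) :
  variety K -> K A -> x <> y ->
  exists (Q : heyting) (f : A -> Q), [/\ K Q, well_connected Q, hom f,
    forall b, exists a, f a = b & f x <> f y].
Proof.
move=> vK KA.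
wlog nxy : x y / ~ hle x y.
  move=> wl xy; have [h|/wl] := pselect (hle x y); last exact.
  have nyx : ~ hle y x by move=> /(hle_anti h).
  have [Q [f [? ? ? ? fyx]]] := wl _ _ nyx (nesym xy).
  by exists Q, f; split=> //; apply: nesym.
move=> xy; have [F [Fx Fy Fup FI FU]] := prime_filter_separation nxy.
have F1 : F htop by apply: Fup Fx _; apply: hlex1.
exists (quotient F1 Fup FI), (quo_pi F).
have homF := quotient_hom F1 Fup FI.
have surjF := @quotient_surj _ _ F1 Fup FI.
split=> //; first exact: variety_surj homF _ vK surjF KA.
  apply: quotient_well_connected => // F0; apply: Fy.
  exact: (Fup _ _ F0 (hle0x _)).
have /(quotient_top F1 Fup FI) -> := Fx.
by move=> /esym/(quotient_top F1 Fup FI).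
Qed.

(** * The ascending ladder algebra *)

(* The upsets of the poset of natural numbers in which [m] is below [n] iff
   [m = n] or [m + 2 <= n], with a top point adjoined, that are empty or
   cofinite: [AscU n] is [{j | n <= j}] and [AscV n] is
   [{n} U {j | n + 2 <= j}] (both with the top point). *)
Inductive asc_car : Type := Asc0 | AscU of nat | AscV of nat.

Definition asc_le (x y : asc_car) : bool :=
  match x, y with
  | Asc0, _ => true
  | _, Asc0 => false
  | AscU n, AscU m => m <= n
  | AscV n, AscU m => m <= n
  | AscU n, AscV m => m.+2 <= n
  | AscV n, AscV m => (n == m) || (m.+2 <= n)
  end.

Definition asc_meet (x y : asc_car) : asc_car :=
  if asc_le x y then x else if asc_le y x then y else
  match x, y with
  | AscV n, AscV m => AscU (minn n m).+3
  | AscV n, _ => AscU n.+2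
  | _, AscV n => AscU n.+2
  | _, _ => Asc0
  end.

Definition asc_join (x y : asc_car) : asc_car :=
  if asc_le x y then y else if asc_le y x then x else
  match x, y with
  | AscV n, AscV m => AscU (minn n m)
  | AscV n, _ => AscU n
  | _, AscV n => AscU n
  | _, _ => Asc0
  end.

(* The complement of the downset of [n]: the points not seeing [n]. *)
Definition asc_not_below (n : nat) : asc_car :=
  if n is n'.+1 then AscV n' else AscU 1.

Definition asc_imp (x y : asc_car) : asc_car :=
  if asc_le x y then AscU 0 else
  match x, y with
  | AscU n, AscU m => if m == n.+1 then asc_not_below n else AscU m
  | AscV n, AscU m =>
      if m <= n.+2 then asc_not_below n else
      if m == n.+3 then AscV n.+1 else AscU m
  | _, _ => y
  end.

Lemma asc_le_refl x : asc_le x x.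
Proof. by case: x => //= n; rewrite eqxx. Qed.

Lemma asc_le_trans y x z : asc_le x y -> asc_le y z -> asc_le x z.
Proof. by case: x y z => [|n|n] [|m|m] [|k|k] //=; lia. Qed.

Lemma asc_le_anti x y : asc_le x y -> asc_le y x -> x = y.
Proof.
case: x y => [|n|n] [|m|m] //= h1 h2; try lia.
  by congr AscU; lia.
by congr AscV; lia.
Qed.

Lemma asc_le_meet z x y :
  asc_le z (asc_meet x y) <-> asc_le z x /\ asc_le z y.
Proof.
suff -> : asc_le z (asc_meet x y) = asc_le z x && asc_le z y.
  by split=> /andP.
rewrite /asc_meet; case: x y z => [|n|n] [|m|m] [|k|k] //=;
  do ?[case: ifP => ?] => /=; lia.
Qed.

Lemma asc_le_join z x y :
  asc_le (asc_join x y) z <-> asc_le x z /\ asc_le y z.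
Proof.
suff -> : asc_le (asc_join x y) z = asc_le x z && asc_le y z.
  by split=> /andP.
rewrite /asc_join; case: x y z => [|n|n] [|m|m] [|k|k] //=;
  do ?[case: ifP => ?] => /=; lia.
Qed.

Lemma asc_le0x x : asc_le Asc0 x. Proof. by []. Qed.

Lemma asc_lex1 x : asc_le x (AscU 0). Proof. by case: x. Qed.

Lemma asc_le_imp x y z :
  asc_le (asc_meet x y) z <-> asc_le x (asc_imp y z).
Proof.
suff -> : asc_le (asc_meet x y) z = asc_le x (asc_imp y z) by [].
rewrite /asc_meet /asc_imp /asc_not_below.
case: x y z => [|n|n] [|[|m]|[|m]] [|k|k] //=;
  do ?[case: ifP => ?] => /=; lia.
Qed.

Definition asc : heyting :=
  heyting_of_order asc_le_refl asc_le_trans asc_le_anti asc_le_meet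
    asc_le_join asc_le0x asc_lex1 asc_le_imp.

Lemma asc_hleE (x y : asc) : hle x y <-> asc_le x y.
Proof. exact: (order_leE asc_le_refl asc_le_trans asc_le_anti asc_le_meet). Qed.

Lemma asc_himp_UU n : himp (AscU n.+1 : asc) (AscU n.+2) = AscV n.
Proof. by rewrite /himp /= /asc_imp /= ltnn eqxx. Qed.

Lemma asc_join_UV n : hjoin (AscU n.+1 : asc) (AscV n) = AscU n.
Proof. by rewrite /hjoin /= /asc_join /=; do ?[case: ifP => //]; lia. Qed.

Lemma asc_meet_UV n : hmeet (AscU n.+1 : asc) (AscV n) = AscU n.+2.
Proof. by rewrite /hmeet /= /asc_meet /=; do ?[case: ifP => //]; lia. Qed.

Lemma asc_himp_UV n : himp (AscU n : asc) (AscV n) = AscV n.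
Proof. by rewrite /himp /= /asc_imp /=; case: ifP => //; lia. Qed.

Lemma asc_himp_VU n m : n.+1 < m <= n.+3 ->
  himp (AscV n.+1 : asc) (AscU m) = AscV n.
Proof. by move=> h; rewrite /himp /= /asc_imp /=; do ?[case: ifP => //]; lia. Qed.

Definition asc_even : set asc :=
  [set x | match x with Asc0 => True | AscU n => ~~ odd n | AscV _ => False end].

(** An implication between two [AscU] leaves the chain of [AscU] only when the levels are
    consecutive, which even levels never are. *)
Lemma asc_even_subuniverse : subuniverse asc_even.
Proof.
split=> // -[|n|n] [|m|m] //= en em.
- by rewrite /hmeet /= /asc_meet /=; do ?[case: ifP].
- by rewrite /hjoin /= /asc_join /=; do ?[case: ifP].
- rewrite /himp /= /asc_imp /=; do ?[case: ifP => //]; move=> /eqP mE.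
  by move: em; rewrite mE /= en.
Qed.

(** * Complements in an interval of an algebra without 3-antichains *)

Section Complements.
Variables (C : heyting) (bot top : C).
Hypothesis wC : no_3antichain C.

Definition complements (a b : C) : Prop :=
  [/\ hmeet a b = bot, hjoin a b = top, ~ hle a bot & ~ hle b bot].

Let comparable_bot (u v : C) : hle (hmeet u v) bot ->
  hcomparable u v -> hle u bot \/ hle v bot.
Proof.
by move=> uv [] h; [left; rewrite hmeet_l in uv|right; rewrite hmeet_r in uv].
Qed.

Let absorb (a a' b' : C) : hle bot a -> hle a top -> complements a' b' ->
  hle (hmeet a a') bot -> hle a b'.
Proof.
move=> ba atop [I' U' _ _] h.
have -> : a = hjoin (hmeet a a') (hmeet a b') by rewrite -hmeetDr U' hmeet_l.
apply: hle_joinI; last exact: hle_meetr.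
apply: hle_trans h _; rewrite -I'; exact: hle_meetr.
Qed.

Let complements_sym (a b : C) : complements a b -> complements b a.
Proof. by case=> ? ? ? ?; split=> //; rewrite 1?hmeetC 1?hjoinC. Qed.

Let complements_bounds (a b : C) : complements a b -> hle bot a /\ hle a top.
Proof. by case=> <- <- _ _; split; [apply: hle_meetl|apply: hle_joinl]. Qed.

(* Two different complemented pairs would generate a Boolean algebra with three
   atoms. *)
Lemma complements_unique (a b a' b' : C) :
  complements a b -> complements a' b' -> a <> a' -> a = b'.
Proof.
move=> ab ab' neq.
have ba := complements_sym ab; have ba' := complements_sym ab'.
have [[bota atop] [botb btop]] := (complements_bounds ab, complements_bounds ba).
have [bota' atop'] := complements_bounds ab'.
have [botb' btop'] := complements_bounds ba'.
have [I _ na nb] := ab; have [I' _ na' nb'] := ab'.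
have disj (u v s t : C) : hmeet s t = bot -> hle u s -> hle v t ->
    hle (hmeet u v) bot.
  move=> <- us vt; apply: hle_meetI.
    exact: hle_trans (hle_meetl _ _) us.
  exact: hle_trans (hle_meetr _ _) vt.
(* Of two comparable elements that are disjoint over [bot], one is below [bot]. *)
have tri (u v w : C) : hle (hmeet u v) bot -> hle (hmeet u w) bot ->
    hle (hmeet v w) bot -> [\/ hle u bot, hle v bot | hle w bot].
  move=> uv uw vw; have [] := wC u v w => /comparable_bot.
  - by case/(_ uv); [constructor 1|constructor 2].
  - by case/(_ uw); [constructor 1|constructor 3].
  - by case/(_ vw); [constructor 2|constructor 3].
have Ic : hmeet b a = bot by rewrite hmeetC.
have Ic' : hmeet b' a' = bot by rewrite hmeetC.
have le_r := @hle_meetr C; have le_l := @hle_meetl C.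
(* The four meets of [a] or [b] with [a'] or [b'] are pairwise disjoint, so by [tri] at most two of
   them are not below [bot]. If [a] and [a'] are disjoint, the pairs are interchanged; otherwise
   they coincide, against [neq]. *)
have [xc|nx] := pselect (hle (hmeet a a') bot).
  have ab'le : hle a b' by apply: absorb ab' xc.
  have a'b : hle a' b by apply: absorb ab _; rewrite // hmeetC.
  have [|||||] := tri (hmeet a b') (hmeet b a') (hmeet b b').
  - exact: disj I (le_l _ _) (le_l _ _).
  - exact: disj I (le_l _ _) (le_l _ _).
  - exact: disj I' (le_r _ _) (le_r _ _).
  - by rewrite hmeet_l.
  - by rewrite hmeet_r.
  - move=> bb'; apply: hle_anti => //.
    by apply: (absorb _ _ ba); rewrite // hmeetC.
have yw : hle (hmeet a b') bot \/ hle (hmeet b a') bot.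
  have [|||||] := tri (hmeet a a') (hmeet a b') (hmeet b a') => //.
  - exact: disj I' (le_r _ _) (le_r _ _).
  - exact: disj I (le_l _ _) (le_l _ _).
  - exact: disj I (le_l _ _) (le_l _ _).
  - by left.
  - by right.
case: neq; case: yw => [yc|wc].
  have aa' : hle a a' by apply: absorb ba' yc.
  apply: hle_anti => //.
  have b'b : hle b' b by apply: absorb ab _; rewrite // hmeetC.
  have [|||||] := tri (hmeet a a') (hmeet b a') (hmeet b b') => //.
  - exact: disj I (le_l _ _) (le_l _ _).
  - exact: disj I (le_l _ _) (le_l _ _).
  - exact: disj I' (le_r _ _) (le_r _ _).
  - by move=> wc; apply: (absorb _ _ ba); rewrite // hmeetC.
  - by rewrite hmeet_r.
have a'a : hle a' a by apply: absorb ba _; rewrite // hmeetC.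
apply: hle_anti => //.
have bb' : hle b b' by apply: absorb ab' wc.
have [|||||] := tri (hmeet a a') (hmeet a b') (hmeet b b') => //.
- exact: disj I' (le_r _ _) (le_r _ _).
- exact: disj I (le_l _ _) (le_l _ _).
- exact: disj I (le_l _ _) (le_l _ _).
- by move=> yc; apply: absorb ba' yc.
- by rewrite hmeet_l.
Qed.

End Complements.

(** * Homomorphisms from the ascending ladder are determined by its even levels *)

Section AscEven.
Variables (C : heyting) (g h : asc -> C).
Hypothesis wC : no_3antichain C.
Hypotheses (homg : hom g) (homh : hom h).
Hypothesis even_eq : forall n, ~~ odd n -> g (AscU n) = h (AscU n).

(** [AscU n] is the join of [AscU n.+1] with [AscV n], and [AscV n] is the implication from
    [AscU n.+1] to [AscU n.+2]. *)
Lemma asc_hom_odd n : odd n -> g (AscU n.+2) = h (AscU n.+2) ->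
  g (AscU n) = h (AscU n).
Proof.
move=> on e; rewrite -asc_join_UV -asc_himp_UU.
case: homg homh => [_ _ _ gU gM] [_ _ _ hU hM].
by rewrite gU gM hU hM e even_eq //= on.
Qed.

(** Neither complement collapses to the bottom of the interval: the implications in question lie
    below [AscU n], which [f] does not send to [htop]. *)
Lemma asc_hom_complements (f : asc -> C) n :
  hom f -> f (AscU n) <> htop ->
  complements (f (AscU n.+4)) (f (AscU n.+2)) (f (AscU n.+3)) (f (AscV n.+2)).
Proof.
move=> homf fn; have [_ _ fI fU _] := homf; split.
- by rewrite -fI asc_meet_UV.
- by rewrite -fU asc_join_UV.
- apply: (hom_nhle homf fn); rewrite asc_himp_UU; apply/asc_hleE => /=; lia.
- apply: (hom_nhle homf fn); rewrite asc_himp_VU ?asc_hleE /=; lia.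
Qed.

Lemma asc_hom_eqU n : odd n -> g (AscU n) = h (AscU n).
Proof.
move=> on; apply: contrapT => neq.
(* Agreement at [n.+4] would pass to [n.+2] and then to [n]. *)
have neq4 : g (AscU n.+4) <> h (AscU n.+4).
  move=> e; apply: neq; apply: asc_hom_odd => //; apply: asc_hom_odd => //.
  by rewrite /= negbK.
have even_n1 : g (AscU n.+1) = h (AscU n.+1) by rewrite even_eq //= on.
have even_n3 : g (AscU n.+3) = h (AscU n.+3) by rewrite even_eq //= on.
have even_n5 : g (AscU n.+4.+1) = h (AscU n.+4.+1) by rewrite even_eq //= !negbK on.
(* Otherwise both maps would also send the larger [AscU n] to [htop]. *)
have gn : g (AscU n.+1) <> htop.
  move=> e; apply: neq; have le1 : hle (AscU n.+1 : asc) (AscU n).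
    by apply/asc_hleE => /=.
  rewrite (@hle_top _ (g (AscU n))); last by rewrite -e; apply: (hom_hle homg).
  by rewrite (@hle_top _ (h (AscU n))) // -e even_n1; apply: (hom_hle homh).
have hn : h (AscU n.+1) <> htop by rewrite -even_n1.
have cg := asc_hom_complements homg gn.
have ch := asc_hom_complements homh hn; rewrite -even_n3 -even_n5 in ch.
have gh := complements_unique wC cg ch neq4.
have [_ _ _ _ gM] := homg; have [_ _ _ _ hM] := homh.
(* The asymmetry of the ladder: [g (AscV n.+2)] is the implication from [g (AscU n.+3)] to
   [g (AscU n.+4)]. After the interchange this equals [h (AscV n.+3)], which lies below
   [g (AscU n.+3)], contrary to [hom_nhle]. *)
have /(hom_nhle homg gn) : hle (himp (AscV n.+2 : asc) (AscU n.+3)) (AscU n.+1).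
  by rewrite asc_himp_VU ?asc_hleE /=; lia.
apply; rewrite -asc_himp_UU gM gh even_n3 -hM asc_himp_UV.
by apply: (hom_hle homh); apply/asc_hleE => /=.
Qed.

Lemma asc_hom_eq : g = h.
Proof.
have eqU n : g (AscU n) = h (AscU n).
  by have [/asc_hom_eqU|/even_eq] := boolP (odd n).
case: homg homh => [g0 _ _ _ gM] [h0 _ _ _ hM].
apply/funext => -[|n|n]; [by rewrite [LHS]g0 [RHS]h0|exact: eqU|].
by rewrite -asc_himp_UU gM hM !eqU.
Qed.

End AscEven.

Lemma ES_not_asc (K : heyting -> Prop) : variety K ->
  (forall A, K A -> KG A) -> ES_property K -> ~ K asc.
Proof.
move=> vK KKG es Kasc.
pose E := subalgebra asc_even_subuniverse.
pose f : E -> asc := fun x => sval x.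
have homf : hom f by apply: subalgebra_hom.
have KE : K E by apply: (variety_inj homf) vK _ Kasc; apply: sub_car_inj.
have epif : epimorphism K f.
  split=> // C KC g h homg homh gfhf; apply/funext => x; apply: contrapT => neq.
  (* A disagreement in [C] survives in a well-connected quotient, which has no 3-antichain. *)
  have [Q [p [KQ wQ homp _ pneq]]] := well_connected_separation vK KC neq.
  apply: pneq; apply: (congr1 (@^~ x) (_ : p \o g = p \o h)).
  apply: asc_hom_eq; [|exact: hom_comp|exact: hom_comp|].
    exact: KG_no_3antichain (KKG _ KQ) wQ.
  move=> n en /=; congr p.
  exact: (congr1 (@^~ (exist _ (AscU n) en : E)) gfhf).
have [x fx] := es _ _ KE Kasc f epif (AscV 0).
by have := svalP x; rewrite [sval x]fx.
Qed.

(** * Long geodesics of the incomparability graph *)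

(** These are the induced paths with [R] edges in the incomparability graph; shortest paths are of
    this kind. *)
Definition geodesic (A : heyting) (R : nat) (x : nat -> A) : Prop :=
  (forall i, i < R -> ~ hcomparable (x i) (x i.+1)) /\
  (forall i j, i.+2 <= j <= R -> hcomparable (x i) (x j)).

Definition descending_geodesic (A : heyting) (R : nat) (x : nat -> A) : Prop :=
  (forall i, i < R -> ~ hcomparable (x i) (x i.+1)) /\
  (forall i j, i.+2 <= j <= R -> hle (x j) (x i)).

(** If a new point lay on the wrong side of an earlier one, transitivity would relate two
    consecutive points. The relation [L] is abstract so as to cover both the order and its
    converse. *)
Lemma geodesic_orientation (T : Type) (L : T -> T -> Prop) (R : nat)
    (x : nat -> T) :
  (forall a b c, L a b -> L b c -> L a c) ->
  (forall i, i < R -> ~ (L (x i) (x i.+1) \/ L (x i.+1) (x i))) ->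
  (forall i j, i.+2 <= j <= R -> L (x i) (x j) \/ L (x j) (x i)) ->
  L (x 0) (x 2) -> forall i j, i.+2 <= j <= R -> L (x i) (x j).
Proof.
move=> trL inc cmp L02 i j; elim: j i => // j IH i /andP[ij jR].
have far k : k.+2 <= j -> L (x k) (x j.+1).
  move=> kj; have kj' : L (x k) (x j) by apply: IH; lia.
  have [//|h] : L (x k) (x j.+1) \/ L (x j.+1) (x k) by apply: cmp; lia.
  by case: (inc j) => //; right; apply: trL h kj'.
have [ij'|ij'] := leqP i.+2 j; first exact: far.
case: i ij ij' => [|i] ij ij'; first by have -> : j.+1 = 2 by lia.
have [//|h] : L (x i.+1) (x j.+1) \/ L (x j.+1) (x i.+1) by apply: cmp; lia.
case: (inc i); first lia.
by left; apply: trL h; apply: far; lia.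
Qed.

Lemma geodesic_descending (A : heyting) (R : nat) (x : nat -> A) :
  2 < R -> geodesic R x -> exists y : nat -> A, descending_geodesic R y.
Proof.
move=> R2 [inc cmp].
have [h|h] : hcomparable (x 0) (x 2) by apply: cmp; lia.
  have asc := geodesic_orientation
    (fun a b c ab bc => @hle_trans A b a c ab bc) inc cmp h.
  exists (fun i => x (R - i)); split=> [i iR|i j ijR].
    have -> : R - i = (R - i.+1).+1 by lia.
    by move=> /hcomparable_sym; apply: inc; lia.
  by apply: asc; lia.
exists x; split=> //.
apply: (@geodesic_orientation _ (fun a b => hle b a)) => //.
- by move=> a b c ba cb; apply: hle_trans cb ba.
- by move=> i iR /or_comm; apply: inc.
- by move=> i j ij; apply/or_comm; apply: cmp.
Qed.

(** * Embedding a segment of the ascending ladder along a descending geodesic *)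

Section Embedding.
Variables (A : heyting) (N R : nat) (y : nat -> A).
Hypothesis degA : incomparability_degree3 A.
Hypothesis geoy : descending_geodesic R y.
Hypothesis NR : N + 12 <= R.

Let inc i : i < R -> ~ hcomparable (y i) (y i.+1).
Proof. by case: geoy => h _; apply: h. Qed.

Let far i j : i.+2 <= j <= R -> hle (y j) (y i).
Proof. by case: geoy => _; apply. Qed.

(** The points [y i] play the part of [AscV], the joins [u i] that of [AscU]. *)
Let u i := hjoin (y i) (y i.+1).

Let u_le i j : i.+2 <= j < R -> hle (u j) (y i).
Proof. by move=> ij; apply: hle_joinI; apply: far; lia. Qed.

Let nle_u i j : i.+1 < j < R -> ~ hle (y i.+1) (u j).
Proof.
move=> ij h; apply: (@inc i); first lia.
by right; apply: hle_trans h _; apply: u_le; lia.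
Qed.

Let nle i j : i.+1 < j <= R -> ~ hle (y i.+1) (y j).
Proof.
move=> ij h; apply: (@inc i); first lia.
by right; apply: hle_trans h _; apply: far; lia.
Qed.

(** The three listed elements are distinct and incomparable to [y i.+2], so the degree bound
    excludes a fourth. *)
Lemma geodesic_neighbours i w : i.+4 <= R -> ~ hcomparable (y i.+2) w ->
  [\/ w = y i.+3, w = u i.+3 | w = y i.+1].
Proof.
move=> iR yw.
have n1 : ~ hcomparable (y i.+2) (y i.+3) by apply: inc; lia.
have n2 : ~ hcomparable (y i.+2) (u i.+3).
  case=> h; first by apply: nle_u h; lia.
  by apply: n1; right; apply: hle_trans h; apply: hle_joinl.
have n3 : ~ hcomparable (y i.+2) (y i.+1).
  by move=> /hcomparable_sym; apply: inc; lia.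
have n12 : y i.+3 <> u i.+3.
  move=> h; apply: (@inc i.+3); first lia.
  by right; rewrite h; apply: hle_joinr.
have n13 : y i.+3 <> y i.+1.
  by move=> h; apply: (@nle i i.+3); [lia|rewrite -h; apply: hle_refl].
have n23 : u i.+3 <> y i.+1.
  by move=> h; apply: (@nle_u i i.+3); [lia|rewrite -h; apply: hle_refl].
have [[]//|[[]//|[]//]] := degA (y i.+2) (y i.+3) (u i.+3) (y i.+1) w.
- by constructor 1.
- by constructor 2.
- by constructor 3.
Qed.

(** The shift by 3 keeps some points of the geodesic before the image, for use in arguments about
    neighbours. *)
Definition asc_embed (x : asc) : A :=
  match x with Asc0 => hbot | AscU n => u n.+3 | AscV n => y n.+3 end.

(** For nonzero [x], index at most [N] means that [x] is above [AscU N]; [AscV n] is above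
    [AscU n.+2]. The value 0 puts [Asc0] in every segment. *)
Definition asc_index (x : asc) : nat :=
  match x with Asc0 => 0 | AscU n => n | AscV n => n.+2 end.

(** The slack beyond [N] covers the elements given by [asc_embed_onto] and their meets with the
    segment. *)
Lemma asc_embed_hle x z : asc_index x <= N + 5 -> asc_index z <= N + 5 ->
  hle (asc_embed x) (asc_embed z) <-> asc_le x z.
Proof.
have y0 i : i < R -> ~ hle (y i) hbot.
  by move=> iR h; apply: (inc iR); left; apply: hle_trans h (hle0x _).
have yu i j : i <= j <= R -> hle (y j) (u i).
  move=> /andP[ij jR]; move: ij.
  rewrite leq_eqVlt => /orP[/eqP->|]; first exact: hle_joinl.
  rewrite leq_eqVlt => /orP[/eqP<-|ij]; first exact: hle_joinr.
  by apply: hle_trans (hle_joinl _ _); apply: far; lia.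
have uu i j : i <= j < R -> hle (u j) (u i).
  by move=> ij; apply: hle_joinI; apply: yu; lia.
case: x z => [|n|n] [|m|m] //= nN mN; split=> //; try by move=> _; apply: hle0x.
- move=> h; case: (y0 n.+3); first lia.
  by apply: hle_trans h; apply: hle_joinl.
- move=> h; rewrite leqNgt; apply/negP => nm.
  by apply: (@nle_u n.+2 m.+3); [lia|apply: hle_trans h; apply: hle_joinl].
- by move=> mn; apply: uu; lia.
- move=> h; rewrite ltnNge; apply/negP => nm.
  have h1 : hle (y n.+3) (y m.+3) by apply: hle_trans h; apply: hle_joinl.
  have h2 : hle (y n.+4) (y m.+3) by apply: hle_trans h; apply: hle_joinr.
  have : (n == m.+1) || (n == m) || (n < m) by lia.
  case/orP=> [/orP[/eqP nE|/eqP nE]|{}nm].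
  + by subst n; apply: (@inc m.+3); [lia|right].
  + by subst n; apply: (@inc m.+3); [lia|right].
  + by apply: (@nle n.+2 m.+3) => //; lia.
- by move=> mn; apply: u_le; lia.
- by move=> h; case: (y0 n.+3) => //; lia.
- move=> h; rewrite leqNgt; apply/negP => nm.
  by apply: (@nle_u n.+2 m.+3) => //; lia.
- by move=> mn; apply: yu; lia.
- move=> h; case: (ltngtP n m) => //= nm.
    by case: (@nle n.+2 m.+3) => //; lia.
  rewrite ltnNge; apply/negP => nm'; have nE : n = m.+1 by lia.
  by subst n; apply: (@inc m.+3); [lia|right].
- by move=> /orP[/eqP->|mn]; [apply: hle_refl|apply: far; lia].
Qed.

Let q := asc_embed (AscU 0).

(** Take a level [j] with [w] below [u j.+3] but not below [u j.+4], and compare [w] with [y j.+4]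
    and [y j.+3]. Incomparability makes [w] a known neighbour, and only [y j.+3] is possible;
    otherwise [w] is above both points and equals [u j.+3]. *)
Lemma asc_embed_onto w : hle w q ->
  hle w (asc_embed (AscU N)) \/
  exists2 c, asc_index c <= N + 2 & w = asc_embed c.
Proof.
move=> wq; have [wN|nwN] := pselect (hle w (asc_embed (AscU N))); first by left.
right; have [j [jN wj nwj]] : exists j, [/\ j < N, hle w (u j.+3) &
    ~ hle w (u j.+4)].
  suff H k : k <= N -> ~ hle w (u k.+3) ->
      exists j, [/\ j < k, hle w (u j.+3) & ~ hle w (u j.+4)].
    by have [j [? ? ?]] := H N (leqnn _) nwN; exists j.
  elim: k => [//|k IH] kN nw.
  have [h|/(IH (ltnW kN))[j [jk ? ?]]] := pselect (hle w (u k.+3)).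
    by exists k.
  by exists j; split=> //; apply: ltnW.
have ule i : hle (u i.+2) (u i.+1) \/ R <= i.+3.
  have [h|] := ltnP i.+3 R; last by right.
  left; apply: hle_joinI; first exact: hle_joinr.
  by apply: hle_trans (hle_joinl _ _); apply: far; lia.
have [wy|wy] := pselect (hcomparable (y j.+4) w); last first.
  exists (AscV j) => /=; first lia.
  have jR : j.+2.+4 <= R by lia.
  have [] // := geodesic_neighbours jR wy.
    by move=> wE; case: nwj; rewrite wE; apply: hle_joinr.
  move=> wE; case: nwj; rewrite wE.
  by have [//|] := ule j.+3; lia.
case: wy => [yw|wy]; last by case: nwj; apply: hle_trans wy (hle_joinl _ _).
have [wy'|wy'] := pselect (hcomparable (y j.+3) w); last first.
  have jR : j.+1.+4 <= R by lia.
  have [] := geodesic_neighbours jR wy'.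
  - by move=> wE; case: nwj; rewrite wE; apply: hle_joinl.
  - by move=> wE; case: nwj; rewrite wE; apply: hle_refl.
  - move=> wE; case: (@nle_u j.+1 j.+3); first lia.
    by rewrite -wE.
case: wy' => [yw'|wy'].
  exists (AscU j) => /=; first lia.
  by apply: hle_anti => //; apply: hle_joinI.
case: (@inc j.+3); first lia.
by right; apply: hle_trans yw wy'.
Qed.

Implicit Types x z c : asc.

Lemma asc_index_meet x z k :
  asc_index x <= k -> asc_index z <= k -> asc_index (hmeet x z) <= k.+1.
Proof.
rewrite /hmeet /= /asc_meet.
by case: x z => [|n|n] [|m|m] //=; do ?[case: ifP => ?] => /=; lia.
Qed.

Lemma asc_index_leU x : x <> Asc0 -> asc_index x <= N <-> asc_le (AscU N) x.
Proof. by case: x. Qed.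

Lemma asc_index_up x z : x <> Asc0 -> hle x z -> asc_index x <= N ->
  asc_index z <= N.
Proof. by move=> x0 /asc_hleE; case: x z x0 => [|n|n] [|m|m] //=; lia. Qed.

Lemma asc_index_himp x z : asc_index z <= N -> asc_index (himp x z) <= N.
Proof.
move=> zN; have [zE|z0] := pselect (z = Asc0); last first.
  exact: asc_index_up z0 (hle_himp _ _) zN.
by rewrite zE; case: x.
Qed.

Lemma asc_index_join x z : asc_index x <= N -> asc_index z <= N ->
  asc_index (hjoin x z) <= N.
Proof.
move=> xN zN; have [xE|x0] := pselect (x = Asc0); last first.
  exact: asc_index_up x0 (hle_joinl _ _) xN.
by rewrite xE hjoin_r //; apply/asc_hleE.
Qed.

Lemma asc_index_meetN x z : asc_index x <= N -> asc_index z <= N ->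
  asc_index (hmeet x z) <= N.
Proof.
move=> xN zN; have [xE|x0] := pselect (x = Asc0).
  by rewrite xE hmeet_l //; apply/asc_hleE.
have [zE|z0] := pselect (z = Asc0).
  by rewrite zE hmeet_r //; apply/asc_hleE.
suff h : hle (AscU N : asc) (hmeet x z) by apply: asc_index_up h _.
by apply: hle_meetI; apply/asc_hleE/asc_index_leU.
Qed.

Let embed_hle x z : asc_index x <= N + 5 -> asc_index z <= N + 5 ->
  hle (asc_embed x) (asc_embed z) <-> hle x z.
Proof. by move=> xN zN; rewrite asc_embed_hle // asc_hleE. Qed.

Let embed_leU x : x <> Asc0 -> asc_index x <= N ->
  hle (asc_embed (AscU N)) (asc_embed x).
Proof.
move=> x0 xN; apply/asc_embed_hle; [by rewrite /=; lia|lia|].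
exact/asc_index_leU.
Qed.

Let embed_q x : asc_index x <= N -> hle (asc_embed x) q.
Proof.
move=> xN; apply/embed_hle => //; first lia.
exact/asc_hleE/asc_lex1.
Qed.

(** Here, and for join and implication, the hard inequality concerns some [w] below [q]. By
    [asc_embed_onto], either [w] is in the image, where the order is reflected, or it is below the
    image of [AscU N], hence below the images of all nonzero elements of the segment. *)
Lemma asc_embed_meet x z : asc_index x <= N -> asc_index z <= N ->
  asc_embed (hmeet x z) = hmeet (asc_embed x) (asc_embed z).
Proof.
move=> xN zN; have xzN := asc_index_meetN xN zN.
apply: hle_anti.
  apply: hle_meetI; apply/embed_hle; try lia; [exact: hle_meetl|].
  exact: hle_meetr.
have [xE|x0] := pselect (x = Asc0).
  rewrite xE (_ : asc_embed Asc0 = hbot) // hmeet0x; exact: hle0x.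
have [zE|z0] := pselect (z = Asc0).
  rewrite zE (_ : asc_embed Asc0 = hbot) // hmeetC hmeet0x; exact: hle0x.
set w := hmeet _ _; have wx : hle w (asc_embed x) by apply: hle_meetl.
have wz : hle w (asc_embed z) by apply: hle_meetr.
have [h|[c cN wE]] := asc_embed_onto (hle_trans wx (embed_q xN)).
  apply: hle_trans h _; apply: embed_leU => // xz0.
  have /asc_hleE : hle (AscU N : asc) (hmeet x z); last by rewrite xz0.
  by apply: hle_meetI; apply/asc_hleE/asc_index_leU.
rewrite wE in wx wz *; apply/embed_hle; try lia.
by apply: hle_meetI; apply/embed_hle => //; lia.
Qed.

Lemma asc_embed_join x z : asc_index x <= N -> asc_index z <= N ->
  asc_embed (hjoin x z) = hjoin (asc_embed x) (asc_embed z).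
Proof.
have UN : asc_index (AscU N) <= N by [].
move=> xN zN; have xzN := asc_index_join xN zN.
apply: hle_anti; last first.
  by apply: hle_joinI; apply/embed_hle; try lia; [apply: hle_joinl|apply: hle_joinr].
have [xE|x0] := pselect (x = Asc0).
  rewrite xE hjoin_r; first exact: hle_joinr.
  exact/asc_hleE.
set w := (X in hle _ X); have wx : hle (asc_embed x) w by apply: hle_joinl.
have wz : hle (asc_embed z) w by apply: hle_joinr.
have wq : hle w q by apply: hle_joinI; apply: embed_q.
have [h|[c cN wE]] := asc_embed_onto wq.
  have wE : w = asc_embed (AscU N).
    by apply: hle_anti => //; apply: hle_trans wx; apply: embed_leU.
  rewrite wE in wx wz *; apply/embed_hle; try lia.
  by apply: hle_joinI; apply/embed_hle => //; lia.
rewrite wE in wx wz *; apply/embed_hle; try lia.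
by apply: hle_joinI; apply/embed_hle => //; lia.
Qed.

Lemma asc_embed_himp x z : asc_index x <= N -> asc_index z <= N ->
  asc_embed (himp x z) = hmeet q (himp (asc_embed x) (asc_embed z)).
Proof.
move=> xN zN; have xzN := asc_index_himp x zN.
apply: hle_anti.
  apply: hle_meetI; first exact: embed_q.
  apply: hle_impI; rewrite -asc_embed_meet //.
  apply/embed_hle; [have := asc_index_meet xzN xN; lia|lia|].
  rewrite hmeetC; exact: himp_mp.
set w := hmeet _ _; have wq : hle w q by apply: hle_meetl.
have wx : hle (hmeet w (asc_embed x)) (asc_embed z).
  apply: hle_trans (himp_mp (asc_embed x) _); apply: hle_meetI.
    exact: hle_meetr.
  exact: hle_trans (hle_meetl _ _) (hle_meetr _ _).
have [h|[c cN wE]] := asc_embed_onto wq.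
  have [zE|z0] := pselect (z = Asc0); last first.
    apply: hle_trans h (hle_trans (embed_leU z0 zN) _).
    by apply/embed_hle; [lia|lia|apply: hle_himp].
  have [xE|x0] := pselect (x = Asc0); first by rewrite xE.
  (* With [z] zero and [x] nonzero, [w] is below the image of [x], hence below [hbot]. *)
  have := hle_trans h (embed_leU x0 xN) => wx'.
  rewrite hmeet_l // zE in wx.
  exact: hle_trans wx (hle0x _).
rewrite wE in wx *; apply/embed_hle; try lia.
have cxN : asc_index (hmeet c x) <= N + 3.
  by have := @asc_index_meet c x (N + 2); lia.
apply: hle_impI; apply/embed_hle; try lia.
apply: hle_trans wx; apply: hle_meetI; apply/embed_hle; try lia.
  exact: hle_meetl.
exact: hle_meetr.
Qed.

Fixpoint asc_depth (v : nat -> asc) (t : term) : nat :=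
  match t with
  | Var n => asc_index (v n)
  | Meet s t | Join s t | Imp s t => maxn (asc_depth v s) (asc_depth v t)
  | _ => 0
  end.

(** The embedding respects the operations relative to the new top [q]; [himp_meetE] settles
    implication. *)
Lemma asc_embed_eval (v : nat -> asc) (t : term) : asc_depth v t <= N ->
  asc_index (eval v t) <= N /\
  asc_embed (eval v t) = hmeet q (eval (asc_embed \o v) t).
Proof.
elim: t => [n|||s IHs t IHt|s IHs t IHt|s IHs t IHt] /=; rewrite ?geq_max.
- by move=> vn; split=> //; rewrite hmeet_r //; apply: embed_q.
- by split=> //; rewrite hmeetC hmeet0x.
- by split=> //; rewrite hmeetx1.
- move=> /andP[/IHs[sN sE] /IHt[tN tE]]; split; first exact: asc_index_meetN.
  rewrite asc_embed_meet // sE tE; apply: hle_anti.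
    apply: hle_meetI; first exact: hle_trans (hle_meetl _ _) (hle_meetl _ _).
    apply: hle_meetI; first exact: hle_trans (hle_meetl _ _) (hle_meetr _ _).
    exact: hle_trans (hle_meetr _ _) (hle_meetr _ _).
  apply: hle_meetI; (apply: hle_meetI; first exact: hle_meetl).
    exact: hle_trans (hle_meetr _ _) (hle_meetl _ _).
  exact: hle_trans (hle_meetr _ _) (hle_meetr _ _).
- move=> /andP[/IHs[sN sE] /IHt[tN tE]]; split; first exact: asc_index_join.
  by rewrite asc_embed_join // sE tE hmeetDr.
- move=> /andP[/IHs[sN sE] /IHt[tN tE]]; split; first exact: asc_index_himp.
  by rewrite asc_embed_himp // sE tE -himp_meetE.
Qed.

End Embedding.

Lemma asc_in_variety (K : heyting -> Prop) : variety K ->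
  (forall R, exists A : heyting, [/\ K A, incomparability_degree3 A &
    exists x : nat -> A, geodesic R x]) -> K asc.
Proof.
move=> [E KE] long; apply/KE => s t st v.
(* An equation involves finitely many values, so a long enough segment of the ladder contains them
   all. *)
pose N := maxn (asc_depth v s) (asc_depth v t).
have [A [/KE KA degA [x /geodesic_descending]]] := long (N + 12).
case=> [|y geoy]; first lia.
have embE := asc_embed_eval degA geoy (leqnn _).
have [sN sE] := embE v s (leq_maxl _ _).
have [tN tE] := embE v t (leq_maxr _ _).
have e : asc_embed y (eval v s) = asc_embed y (eval v t).
  by rewrite sE tE (KA _ _ st).
have le := asc_embed_hle geoy (leqnn (N + 12)).
by apply: asc_le_anti; apply/le; rewrite ?e; try lia; apply: hle_refl.
Qed.

(** * Cardinality bounds *)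

(** A bound on size through an enumeration that may repeat values or leave [P]; it yields numbers
    uniform over all algebras. *)
Definition covered (T : Type) (n : nat) (P : set T) : Prop :=
  exists f : nat -> T, forall x, P x -> exists2 i, i < n & f i = x.

Lemma sub_covered (T : Type) (n : nat) (P Q : set T) :
  P `<=` Q -> covered n Q -> covered n P.
Proof. by move=> PQ [f fQ]; exists f => x /PQ/fQ. Qed.

Lemma covered1 (T : Type) (a : T) : covered 1 [set a].
Proof. by exists (fun=> a) => x ->; exists 0. Qed.

Lemma coveredU (T : Type) (m n : nat) (P Q : set T) :
  covered m P -> covered n Q -> covered (m + n) (P `|` Q).
Proof.
move=> [f fP] [g gQ]; exists (fun i => if i < m then f i else g (i - m)) => x.
case=> [/fP[i im <-]|/gQ[i iN <-]].
  by exists i; [lia|rewrite im].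
by exists (m + i); [lia|rewrite ltnNge leq_addr /= addKn].
Qed.

Lemma covered_bigcup (T : Type) (m n : nat) (P : set T) (Q : T -> set T) :
  covered m P -> (forall x, P x -> covered n (Q x)) ->
  covered (m * n) (\bigcup_(x in P) Q x).
Proof.
move=> [f fP] cQ.
have /choice[g gQ] : forall x, exists h : nat -> T,
    P x -> forall z, Q x z -> exists2 i, i < n & h i = z.
  move=> x; have [Px|nPx] := pselect (P x); last by exists f.
  by have [h hQ] := cQ x Px; exists h.
(* Pairs of indices are coded by quotient and remainder. *)
exists (fun i => g (f (i %/ n)) (i %% n)) => z [x Px Qxz].
have [j jn jz] := gQ x Px z Qxz; have [i im ix] := fP x Px.
exists (i * n + j); first by nia.
by rewrite divnMDl ?(leq_ltn_trans _ jn) // modnMDl divn_small // modn_small //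
  addn0 ix.
Qed.

Lemma covered_image (T U : Type) (n : nat) (P : set T) (h : T -> U) :
  covered n P -> covered n (h @` P).
Proof.
move=> [f fP]; exists (h \o f) => _ [x /fP[i iN <-] <-].
by exists i.
Qed.

Lemma finite_covered (T : Type) (x0 : T) (X : set T) :
  finite_set X -> exists n, covered n X.
Proof.
move=> /finite_setP[n /card_eqPle[/pcard_leP/unsquash h _]]; exists n.
have injh : {in X &, injective h} by exact: inj.
have /choice[f fP] : forall i, exists x, forall y, X y -> h y = i -> x = y.
  move=> i; have [[x [Xx hx]]|none] := pselect (exists x, X x /\ h x = i).
    by exists x => y Xy hy; apply: injh; rewrite ?inE // hx hy.
  by exists x0 => y Xy hy; case: none; exists y.
exists f => x Xx; exists (h x); last exact: fP.
exact: (@funS _ _ _ _ h x Xx).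
Qed.

(** * Local finiteness without long geodesics *)

Section Balls.
Variable A : heyting.
Hypothesis degA : incomparability_degree3 A.

Lemma covered_incomparable (x : A) : covered 3 [set y | ~ hcomparable x y].
Proof.
set P := [set y | _].
have [[y1 P1]|h] := pselect (exists y, P y); last first.
  by exists (fun=> x) => y Py; case: h; exists y.
have [[y2 [P2 n2]]|h] := pselect (exists y, P y /\ y <> y1); last first.
  exists (fun=> y1) => y Py; exists 0 => //.
  by apply: contrapT => n; apply: h; exists y; split=> //; apply: nesym.
have [[y3 [P3 n31 n32]]|h] :=
    pselect (exists y, [/\ P y, y <> y1 & y <> y2]); last first.
  exists (nth y1 [:: y1; y2]) => y Py.
  have [->|ny1] := pselect (y = y1); first by exists 0.
  have [->|ny2] := pselect (y = y2); first by exists 1.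
  by case: h; exists y.
exists (nth y1 [:: y1; y2; y3]) => y Py.
have [[]//|[[]|[]]] := degA x y1 y2 y3 y.
- by move/esym.
- by move/esym.
- by move=> yE; exists 0.
- by move/esym.
- by move=> yE; exists 1.
- by move=> yE; exists 2.
Qed.

Fixpoint ball (b : A) (n : nat) : set A :=
  if n is m.+1 then
    ball b m `|` [set x | exists2 y, ball b m y & ~ hcomparable y x]
  else [set b].

Lemma covered_ball b n : covered (4 ^ n) (ball b n).
Proof.
elim: n => [|n IH]; first exact: covered1.
rewrite expnSr; pose Q y : set A := [set y] `|` [set x | ~ hcomparable y x].
apply: (@sub_covered _ _ _ (\bigcup_(y in ball b n) Q y)).
  by move=> x [Bx|[y By xy]]; [exists x => //; left|exists y => //; right].
apply: covered_bigcup => // y _.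
exact: (@coveredU _ 1 3 _ _ (covered1 _) (covered_incomparable _)).
Qed.

Lemma ball_mono b m n : m <= n -> ball b m `<=` ball b n.
Proof.
elim: n => [|n IH]; first by rewrite leqn0 => /eqP->.
by rewrite leq_eqVlt => /orP[/eqP->//|/IH h] x /h; left.
Qed.

Definition sphere b n : set A :=
  [set x | ball b n x /\ forall k, k < n -> ~ ball b k x].

Lemma sphere_path b n z : sphere b n z ->
  exists x : nat -> A, [/\ x n = z, forall i, i <= n -> sphere b i (x i) &
    forall i, i < n -> ~ hcomparable (x i) (x i.+1)].
Proof.
elim: n z => [|n IH] z [Bz nBz].
  by exists (fun=> z); split=> // i; rewrite leqn0 => /eqP->; split.
have [Bnz|[y By yz]] := Bz; first by case: (nBz n).
have Sy : sphere b n y.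
  split=> // k kn Bky; apply: (nBz k.+1) => //.
  by right; exists y.
have [x [xn xS xinc]] := IH y Sy.
exists (fun i => if i <= n then x i else z); split.
- by rewrite ltnn.
- move=> i; rewrite leq_eqVlt ltnS => /orP[/eqP->|iN].
    by rewrite ltnn; split.
  by rewrite iN; apply: xS.
- move=> i iSn; have [->|iN] : i = n \/ i < n by lia.
    by rewrite leqnn ltnn xn.
  by rewrite iN (ltnW iN); apply: xinc.
Qed.

(** If [x i] and [x j] were incomparable, [x j] would lie in the ball of radius [i.+1], which is
    less than [j]. *)
Lemma sphere_geodesic b n z : sphere b n z -> exists x : nat -> A, geodesic n x.
Proof.
move=> /sphere_path[x [_ xS xinc]]; exists x; split=> // i j /andP[ij jn].
apply: contrapT => nij; have [_ nBj] := xS j jn.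
apply: (nBj i.+1) => //; right; exists (x i) => //.
by have [] := xS i _; first lia.
Qed.

(** * Nodes and the intervals between them *)

Definition node (c : A) : Prop := forall x, hcomparable c x.

Lemma covered_glb n (P : set A) : covered n P ->
  exists p, (forall x, P x -> hle p x) /\
    forall z, (forall x, P x -> hle z x) -> hle z p.
Proof.
move=> [f fP].
suff H k : exists p, (forall i, i < k -> P (f i) -> hle p (f i)) /\
    forall z, (forall x, P x -> hle z x) -> hle z p.
  have [p [pP pglb]] := H n; exists p; split=> // x Px.
  by have [i iN fi] := fP x Px; rewrite -fi; apply: pP => //; rewrite fi.
elim: k => [|k [p [pP pglb]]]; first by exists htop; split=> // z _; apply: hlex1.
have [Pk|nPk] := pselect (P (f k)); last first.
  exists p; split=> // i; rewrite ltnS leq_eqVlt => /orP[/eqP->//|]; exact: pP.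
exists (hmeet p (f k)); split=> [i|z zP].
  rewrite ltnS leq_eqVlt => /orP[/eqP-> _|ik Pi]; first exact: hle_meetr.
  exact: hle_trans (hle_meetl _ _) (pP i ik Pi).
by apply: hle_meetI; [apply: pglb|apply: zP].
Qed.

Lemma covered_lub n (P : set A) : covered n P ->
  exists q, (forall x, P x -> hle x q) /\
    forall z, (forall x, P x -> hle x z) -> hle q z.
Proof.
move=> [f fP].
suff H k : exists q, (forall i, i < k -> P (f i) -> hle (f i) q) /\
    forall z, (forall x, P x -> hle x z) -> hle q z.
  have [q [qP qlub]] := H n; exists q; split=> // x Px.
  by have [i iN fi] := fP x Px; rewrite -fi; apply: qP => //; rewrite fi.
elim: k => [|k [q [qP qlub]]]; first by exists hbot; split=> // z _; apply: hle0x.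
have [Pk|nPk] := pselect (P (f k)); last first.
  exists q; split=> // i; rewrite ltnS leq_eqVlt => /orP[/eqP->//|]; exact: qP.
exists (hjoin q (f k)); split=> [i|z zP].
  rewrite ltnS leq_eqVlt => /orP[/eqP-> _|ik Pi]; first exact: hle_joinr.
  exact: hle_trans (qP i ik Pi) (hle_joinl _ _).
by apply: hle_joinI; [apply: qlub|apply: zP].
Qed.

(** The ball is connected, and a change of side along an edge would make its ends comparable. *)
Lemma ball_side b n x : (forall y, ball b n y -> hcomparable x y) ->
  (forall y, ball b n y -> hle x y) \/ (forall y, ball b n y -> hle y x).
Proof.
elim: n => [|n IH] cmp.
  have [xb|bx] := cmp b erefl; first by left=> y ->.
  by right=> y ->.
have {}IH := IH (fun y By => cmp y (or_introl By)).
case: IH => side; [left|right] => z [/side//|[y By yz]].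
  have [//|zx] := cmp z (or_intror (ex_intro2 _ _ y By yz)).
  by case: yz; right; apply: hle_trans zx (side y By).
have [xz|//] := cmp z (or_intror (ex_intro2 _ _ y By yz)).
by case: yz; left; apply: hle_trans (side y By) xz.
Qed.

Lemma node_interval r : (forall x : nat -> A, ~ geodesic r.+1 x) ->
  forall b, exists p q, [/\ node p, node q, hle p b, hle b q &
    covered (4 ^ r + 2) [set x | hle p x /\ hle x q]].
Proof.
move=> short b; pose C := ball b r.
(* A neighbour outside the ball would be at distance [r.+1] and give a geodesic of that length, so
   [C] is the component of [b]. *)
have closedC x y : C x -> ~ hcomparable x y -> C y.
  move=> Cx xy; apply: contrapT => nCy.
  have : sphere b r.+1 y.
    split; first by right; exists x.
    by move=> k; rewrite ltnS => kr /(ball_mono kr).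
  by move=> /sphere_geodesic[z /short].
have Cb : C b by apply: (@ball_mono b 0).
have [p [pC pglb]] := covered_glb (covered_ball b r).
have [q [qC qlub]] := covered_lub (covered_ball b r).
have sides x : [\/ C x, hle x p | hle q x].
  have [Cx|nCx] := pselect (C x); first by constructor 1.
  have cmp y : ball b r y -> hcomparable x y.
    move=> By; apply: contrapT => xy; apply: nCx.
    by apply: closedC By _ => /hcomparable_sym.
  have [/pglb|/qlub] := ball_side cmp; by [constructor 2|constructor 3].
have pq : hle p q by apply: hle_trans (pC _ Cb) (qC _ Cb).
exists p, q; split.
- move=> x; have [/pC|h|h] := sides x; [by left|by right|].
  by left; apply: hle_trans pq h.
- move=> x; have [/qC|h|h] := sides x; [by right| |by left].
  by right; apply: hle_trans h pq.
- exact: pC.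
- exact: qC.
apply: (@sub_covered _ _ _ (C `|` ([set p] `|` [set q]))); last first.
  apply: coveredU; first exact: covered_ball.
  exact: (coveredU (covered1 p) (covered1 q)).
move=> x [px xq]; have [Cx|xp|qx] := sides x; first by left.
  by right; left; apply: hle_anti.
by right; right; apply: hle_anti.
Qed.

Lemma node_intervals_subuniverse (I : A -> A -> Prop) :
  (forall p q, I p q -> node p /\ node q) -> I hbot hbot -> I htop htop ->
  subuniverse [set x | exists p q, [/\ I p q, hle p x & hle x q]].
Proof.
move=> nodeI I0 I1.
split.
- by exists hbot, hbot; split=> //; apply: hle_refl.
- by exists htop, htop; split=> //; apply: hle_refl.
(* Incomparable elements lie in a common interval, because its ends are nodes. *)
- move=> x y Sx Sy; have [[h|h]|nxy] := pselect (hcomparable x y).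
  + by rewrite hmeet_l.
  + by rewrite hmeet_r.
  have [p [q [Ipq px xq]]] := Sx; have [np nq] := nodeI _ _ Ipq.
  exists p, q; split=> //; last exact: hle_trans (hle_meetl _ _) xq.
  apply: hle_meetI => //; have [//|yp] := np y.
  by case: nxy; right; apply: hle_trans yp px.
- move=> x y Sx Sy; have [[h|h]|nxy] := pselect (hcomparable x y).
  + by rewrite hjoin_r.
  + by rewrite hjoin_l.
  have [p [q [Ipq px xq]]] := Sx; have [np nq] := nodeI _ _ Ipq.
  exists p, q; split=> //; first exact: hle_trans px (hle_joinl _ _).
  apply: hle_joinI => //; have [qy|//] := nq y.
  by case: nxy; left; apply: hle_trans xq qy.
- move=> x y [p [q [Ipq px xq]]] Sy; have [np nq] := nodeI _ _ Ipq.
  have [/himp_top->|nxy] := pselect (hle x y).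
    by exists htop, htop; split=> //; apply: hle_refl.
  have nxw : ~ hle x (himp x y).
    by move=> h; apply: nxy; have := himp_mp x y; rewrite hmeet_l.
  (* If [p] is below [y], the implication stays in the interval of [x]; otherwise it equals [y]. *)
  have [py|npy] := pselect (hle p y).
    exists p, q; split=> //; first exact: hle_trans py (hle_himp _ _).
    have [qw|//] := nq (himp x y).
    by case: nxw; apply: hle_trans xq qw.
  suff -> : himp x y = y by [].
  apply: hle_anti; last exact: hle_himp.
  have [pw|wp] := np (himp x y).
    case: npy; apply: hle_trans (himp_mp x y); exact: hle_meetI.
  by have := himp_mp x y; rewrite hmeet_r //; apply: hle_trans wp px.
Qed.

Lemma covered_generated r k (X : set A) :
  (forall x : nat -> A, ~ geodesic r.+1 x) -> covered k X -> generated_by X ->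
  covered (2 + k * (4 ^ r + 2)) [set: A].
Proof.
move=> short cX gX.
have /choice[pq pqP] : forall b, exists pq : A * A, [/\ node pq.1, node pq.2,
    hle pq.1 b, hle b pq.2 &
    covered (4 ^ r + 2) [set x | hle pq.1 x /\ hle x pq.2]].
  by move=> b; have [p [q H]] := node_interval short b; exists (p, q).
pose Q b : set A := [set x | hle (pq b).1 x /\ hle x (pq b).2].
apply: (@sub_covered _ _ _ ([set hbot] `|` [set htop] `|` \bigcup_(b in X) Q b)).
  (* The two degenerate intervals at the bounds and one node interval for each generator. *)
  pose I p q := [\/ p = hbot /\ q = hbot, p = htop /\ q = htop |
    exists2 b, X b & p = (pq b).1 /\ q = (pq b).2].
  have subI := @node_intervals_subuniverse I; move=> x _.
  have : [set x | exists p q, [/\ I p q, hle p x & hle x q]] x.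
    apply: (generated_by_ind gX); last first.
      move=> b Xb; exists (pq b).1, (pq b).2; have [? ? ? ? ?] := pqP b.
      by split=> //; constructor 3; exists b.
    apply: subI; [|by constructor 1|by constructor 2].
    move=> p q [[-> ->]|[-> ->]|[b _ [-> ->]]].
    - by split=> y; left; apply: hle0x.
    - by split=> y; right; apply: hlex1.
    - by have [? ? ? ? ?] := pqP b.
  move=> [p [q [[[-> ->]|[-> ->]|[b Xb [-> ->]]] px xq]]].
  - by left; left; apply: hlex0.
  - by left; right; apply: hle_top.
  - by right; exists b.
apply: coveredU; first exact: (coveredU (covered1 hbot) (covered1 htop)).
by apply: covered_bigcup => // b _; have [] := pqP b.
Qed.

End Balls.

(** * Finiteness from homomorphisms into algebras of bounded size *)

Section FiniteCodes.
Variables (A : heyting) (X : set A) (k M : nat).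
Hypotheses (cX : covered k X) (gX : generated_by X).

(** Three operation tables on [M.+1] labels, with labels for the bounds and the [k] generators. The
    successor ensures that a default label exists. *)
Definition code : finType :=
  ({ffun 'I_M.+1 * 'I_M.+1 -> 'I_M.+1} * {ffun 'I_M.+1 * 'I_M.+1 -> 'I_M.+1} *
   {ffun 'I_M.+1 * 'I_M.+1 -> 'I_M.+1} * ('I_M.+1 * 'I_M.+1) *
   {ffun 'I_k -> 'I_M.+1})%type.

Definition coded (g : nat -> A) (c : code) (q : A -> 'I_M.+1) : Prop :=
  let: (meet, join, imp, (bot, top), gen) := c in
  [/\ q hbot = bot /\ q htop = top,
      forall x y, q (hmeet x y) = meet (q x, q y),
      forall x y, q (hjoin x y) = join (q x, q y),
      forall x y, q (himp x y) = imp (q x, q y) &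
      forall i : 'I_k, q (g i) = gen i].

Lemma coded_unique g c q q' :
  (forall x, X x -> exists2 i, i < k & g i = x) ->
  coded g c q -> coded g c q' -> q = q'.
Proof.
case: c => [[[[meet join] imp] [bot top]] gen] gP.
move=> [[q0 q1] qI qU qM qg] [[q0' q1'] qI' qU' qM' qg']; apply/funext.
apply: (generated_by_ind gX); last first.
  by move=> x /gP[i ik <-]; rewrite (qg (Ordinal ik)) (qg' (Ordinal ik)).
split=> /=; rewrite ?q0 ?q1 //.
- by move=> x y ex ey; rewrite qI qI' ex ey.
- by move=> x y ex ey; rewrite qU qU' ex ey.
- by move=> x y ex ey; rewrite qM qM' ex ey.
Qed.

Lemma coded_hom g (Q : heyting) (f : A -> Q) : hom f -> covered M [set: Q] ->
  exists (c : code) (q : A -> 'I_M.+1), coded g c q /\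
    forall x y, f x <> f y -> q x <> q y.
Proof.
move=> [f0 f1 fI fU fM] [e eP].
have /choice[rk rkP] : forall z : Q, exists i : 'I_M.+1, e i = z.
  by move=> z; have [i iM <-] := eP z I; exists (Ordinal (leqW iM)).
pose op (o : Q -> Q -> Q) := [ffun ij : 'I_M.+1 * 'I_M.+1 => rk (o (e ij.1) (e ij.2))].
exists (op (@hmeet Q), op (@hjoin Q), op (@himp Q), (rk hbot, rk htop),
  [ffun i : 'I_k => rk (f (g i))]), (rk \o f); split; last first.
  by move=> x y nxy /= h; apply: nxy; rewrite -(rkP (f x)) h rkP.
split=> /=; first by rewrite f0 f1.
- by move=> x y; rewrite ffunE /= !rkP fI.
- by move=> x y; rewrite ffunE /= !rkP fU.
- by move=> x y; rewrite ffunE /= !rkP fM.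
- by move=> i; rewrite ffunE.
Qed.

Lemma finite_separated :
  (forall x y : A, x <> y -> exists (Q : heyting) (f : A -> Q),
    [/\ hom f, covered M [set: Q] & f x <> f y]) ->
  finite_set [set: A].
Proof.
move=> sep; have [g gP] := cX.
(* At most one labelling fits a code; a constant labelling is the default when none does. *)
have /choice[dec decP] : forall c : code, exists q : A -> 'I_M.+1,
    forall q', coded g c q' -> q' = q.
  move=> c; have [[q cq]|none] := pselect (exists q, coded g c q).
    by exists q => q' cq'; apply: coded_unique cq' cq.
  by exists (fun=> ord0) => q' cq'; case: none; exists q'.
(* Each separating homomorphism is recorded by some code, so the labels over all codes determine the
   point. *)
pose Phi (x : A) := [ffun c : code => dec c x].
have injPhi : injective Phi.
  move=> x y Pxy; apply: contrapT => /sep[Q [f [homf cQ /= nxy]]].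
  have [c [q [cq qxy]]] := coded_hom g homf cQ.
  apply: (qxy x y nxy); rewrite (decP c q cq).
  by have := congr1 (fun F : {ffun code -> 'I_M.+1} => F c) Pxy; rewrite !ffunE.
apply: (@finite_preimage _ _ setT Phi); last exact: finite_finset.
by move=> x y _ _; apply: injPhi.
Qed.

End FiniteCodes.

Lemma generated_by_surj (A B : heyting) (f : A -> B) (X : set A) :
  hom f -> (forall b, exists a, f a = b) -> generated_by X ->
  generated_by (f @` X).
Proof.
move=> [f0 f1 fI fU fM] surj gX; apply/seteqP; split=> // b _.
have [a <-] := surj b => Y [[Y0 Y1 YI YU YM] XY].
apply: (generated_by_ind gX (Y := f @^-1` Y)); last first.
  by move=> x Xx; apply: XY; exists x.
split=> /=; rewrite ?f0 ?f1 // => x y Yx Yy.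
- by rewrite fI; apply: YI.
- by rewrite fU; apply: YU.
- by rewrite fM; apply: YM.
Qed.

(** The well-connected quotients separating points are generated by the images of the same [k]
    elements, so [k] and [r] alone bound their size. *)
Lemma short_geodesics_locally_finite (K : heyting -> Prop) (r : nat) :
  variety K -> (forall A, K A -> KG A) ->
  (forall A, K A -> well_connected A -> forall x : nat -> A, ~ geodesic r.+1 x) ->
  locally_finite K.
Proof.
move=> vK KKG short A KA [X finX gX].
have [k cX] := finite_covered hbot finX.
apply: (finite_separated (M := 2 + k * (4 ^ r + 2)) cX gX) => x y nxy.
have [Q [f [KQ wQ homf surjf fxy]]] := well_connected_separation vK KA nxy.
exists Q, f; split=> //.
exact: (covered_generated (KG_degree3 (KKG _ KQ) wQ) (short Q KQ wQ)
  (covered_image f cX) (generated_by_surj homf surjf gX)).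
Qed.

Theorem theorem8p5 (K : heyting -> Prop) (varK : variety K)
  (subK : forall A : heyting, K A -> KG A) (esK : ES_property K) :
  locally_finite K.
Proof.
have [[r short]|long] := pselect (exists r, forall A, K A -> well_connected A ->
  forall x : nat -> A, ~ geodesic r.+1 x).
  exact: short_geodesics_locally_finite short.
exfalso; apply: (ES_not_asc varK subK esK); apply: asc_in_variety varK _ => R.
apply: contrapT => none; apply: long; exists R => A KA wA x [inc cmp].
apply: none; exists A; split=> //; first exact: KG_degree3 (subK _ KA) wA.
(* A geodesic with [R.+1] edges is cut down to its first [R] edges. *)
exists x; split=> [i iR|i j ij]; first by apply: inc; lia.
by apply: cmp; lia.
Qed.
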